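(* Let $G$ be a graph, let $S\subseteq V(G)$, and let $T$ be a tree with $t\geq 2$ vertices, maximum degree $d$ and radius $h$. If $G$ does not contain any $S$-rooted model of $T$, then $\mathrm{ppw}((2t-1)d,G,S)\leq 2h-1$.
   Context: A model of $H$ in $G$ is a collection of pairwise disjoint sets $\{W_v\subseteq V(G)\mid v\in V(H)\}$ (branch sets), each inducing a connected subgraph of $G$, such that for every edge $vw$ of $H$ some vertex of $W_v$ is adjacent to some vertex of $W_w$; it is $S$-rooted if every branch set contains a vertex of $S$. A partition of a set is a collection of nonempty pairwise disjoint parts covering it; its width is the maximum part size; the quotient $H/\mathcal P$ has vertex set $\mathcal P$ with distinct parts adjacent iff some vertex of one is adjacent in $H$ to some vertex of the other. For a positive integer $k$, a $k$-partition-path-decomposition of $(G,S)$ consists of an induced subgraph $H$ of $G$ with $S\subseteq V(H)$, a partition $\mathcal P_H$ of $V(H)$ of width at most $k$, and a path-decomposition $\mathcal D_H$ of $H/\mathcal P_H$ such that for every connected component $C$ of $G-V(H)$ there is a bag $B$ of $\mathcal D_H$ such that $N_G(V(C))$ is contained in the union of the parts belonging to $B$. Its width is the width of $\mathcal D_H$ (max bag size minus one). $\mathrm{ppw}(k,G,S)$ is the minimum width of a $k$-partition-path-decomposition of $(G,S)$. *)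

(* Defs.v *)
From HB Require Import structures.
From mathcomp Require Import all_boot all_order all_algebra.
From mathcomp Require Import boolp.

Set Implicit Arguments.
Unset Strict Implicit.
Unset Printing Implicit Defensive.

Import Order.TTheory GRing.Theory Num.Theory.

Record sgraph := SGraph {
  vertex :> finType;
  adj : rel vertex;
  adj_sym : symmetric adj;
  adj_irrefl : irreflexive adj }.

Section Graphs.
Variable G : sgraph.
Implicit Types (W U C : {set G}) (u v : G).

Definition connected_set W : bool :=
  (W != set0) &&
  [forall x in W, forall y in W,
     connect [rel u v | [&& u \in W, v \in W & adj u v]] x y].

(* The connected components of the subgraph of G induced by U. *)
Definition component U C : bool :=
  maxset (fun D : {set G} => (D \subset U) && connected_set D) C.

Definition neighbourhood W : {set G} :=
  [set y | (y \notin W) && [exists x in W, adj x y]].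

Definition acyclic : Prop :=
  forall c : seq G, ucycle (@adj G) c -> size c <= 2.

Definition is_tree : Prop := connected_set ([set: G]) /\ acyclic.

Definition degree v : nat := #|[set w | adj v w]|.

Definition max_degree : nat := \max_(v : G) degree v.

End Graphs.

(* The least element of P when there is one, and x0 otherwise. *)
Definition minimum (d : Order.disp_t) (T : porderType d) (x0 : T)
    (P : T -> Prop) : T :=
  if pselect (exists x, P x /\ forall y, P y -> (x <= y)%O) is left ex
  then projT1 (cid ex) else x0.

Lemma minimumP (d : Order.disp_t) (T : porderType d) (x0 : T) (P : T -> Prop) :
  (exists x, P x /\ forall y, P y -> (x <= y)%O) ->
  P (minimum x0 P) /\ forall y, P y -> (minimum x0 P <= y)%O.
Proof. by rewrite /minimum; case: pselect => // ex _; case: cid. Qed.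

Section Distance.
Variable G : sgraph.

(* Junk value 0 if u and v lie in different components. *)
Definition dist (u v : G) : nat :=
  minimum 0 (fun n => exists p : seq G,
    [/\ path (@adj G) u p, last u p = v & size p = n]).

Definition eccentricity (u : G) : nat := \max_(v : G) dist u v.

Definition radius : nat := minimum 0 (fun n => exists u : G, eccentricity u = n).

End Distance.

Record model (H G : sgraph) := Model {
  branch :> H -> {set G};
  branch_disjoint : forall v w : H, v != w -> [disjoint branch v & branch w];
  branch_connected : forall v : H, connected_set (branch v);
  branch_adj : forall v w : H, adj v w ->
    exists x y : G, [/\ x \in branch v, y \in branch w & adj x y] }.

Definition rooted (H G : sgraph) (S : {set G}) (M : model H G) : Prop :=
  forall v : H, exists2 x : G, x \in M v & x \in S.

Section Quotient.
Variables (G : sgraph) (P : {set {set G}}).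

Definition quotient_adj : rel {A : {set G} | A \in P} :=
  fun A B => (A != B) && [exists x in val A, exists y in val B, adj x y].

Lemma quotient_adj_sym : symmetric quotient_adj.
Proof.
move=> A B; rewrite /quotient_adj eq_sym; congr (_ && _).
by apply/exists_inP/exists_inP => -[x xA /exists_inP[y yB xy]];
   exists y => //; apply/exists_inP; exists x => //; rewrite adj_sym.
Qed.

Lemma quotient_adj_irrefl : irreflexive quotient_adj.
Proof. by move=> A; rewrite /quotient_adj eqxx. Qed.

(* When P is a partition of X, this is G[X] / P: adjacency in the induced
   subgraph G[X] is adjacency in G. *)
Definition quotient : sgraph := SGraph quotient_adj_sym quotient_adj_irrefl.

End Quotient.

(* The bags are listed in the order of the indexing path, which has at least
   one node. *)
Record path_decomposition (Q : sgraph) (D : seq {set Q}) : Prop :=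
  PathDecomposition {
    pd_nonempty : D != [::];
    pd_vertex : forall x : Q, exists2 B, B \in D & x \in B;
    pd_edge : forall x y : Q, adj x y ->
      exists2 B, B \in D & (x \in B) && (y \in B);
    pd_interval : forall (x : Q) (i j l : nat),
      i <= j -> j <= l -> l < size D ->
      x \in nth set0 D i -> x \in nth set0 D l ->
      x \in nth set0 D j }.

(* The value is -1 when all bags are empty, hence the integers. *)
Definition pd_width (Q : sgraph) (D : seq {set Q}) : int :=
  ((\max_(B <- D) #|B|)%:Z - 1)%R.

Definition partition_width (T : finType) (P : {set {set T}}) : nat :=
  \max_(A in P) #|A|.

(* The induced subgraph H is given by its vertex set ppd_verts. *)
Record ppd (k : nat) (G : sgraph) (S : {set G}) := PPD {
  ppd_verts : {set G};
  ppd_sub : S \subset ppd_verts;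
  ppd_parts : {set {set G}};
  ppd_partition : partition ppd_parts ppd_verts;
  ppd_parts_width : partition_width ppd_parts <= k;
  ppd_bags : seq {set quotient ppd_parts};
  ppd_decomposition : path_decomposition ppd_bags;
  ppd_component : forall C : {set G}, component (~: ppd_verts) C ->
    exists2 B, B \in ppd_bags &
      neighbourhood C \subset \bigcup_(A in B) val A }.

Definition ppd_width (k : nat) (G : sgraph) (S : {set G}) (D : ppd k S) : int :=
  pd_width (ppd_bags D).

(* For k > 0 the minimum exists (ppwP). *)
Definition ppw (k : nat) (G : sgraph) (S : {set G}) : int :=
  minimum (0 : int)%R (fun w => exists D : ppd k S, ppd_width D = w).

Lemma minimum_natP (P : nat -> Prop) : (exists n, P n) ->
  P (minimum 0 P) /\ forall n, P n -> minimum 0 P <= n.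
Proof.
move=> exP.
have exb : exists n, `[< P n >] by case: exP => n Pn; exists n; apply/asboolP.
case: (ex_minnP exb) => m /asboolP Pm minm.
apply: (@minimumP _ _ 0 P).
by exists m; split=> // y Py; apply/minm/asboolP.
Qed.

Section PpwMin.
Variables (k : nat) (G : sgraph) (S : {set G}).
Local Open Scope ring_scope.

Lemma ppd_exists : (0 < k)%N -> inhabited (ppd k S).
Proof.
move=> k0; pose X := [set: G].
pose P : {set {set G}} := [set [set x] | x in X].
have partP : partition P X.
  apply/and3P; split.
  - rewrite eqEsubset subsetT; apply/subsetP => x _.
    by apply/bigcupP; exists [set x];
      [apply: imset_f|]; rewrite ?inE.
  - apply/trivIsetP => _ _ /imsetP[x _ ->] /imsetP[y _ ->] nxy.
    rewrite disjoints1 inE; apply: contra nxy => /eqP ->.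
    by rewrite eqxx.
  - by apply/imsetP => -[x _ /setP/(_ x)]; rewrite !inE eqxx.
have wP : (partition_width P <= k)%N.
  by apply/bigmax_leqP => _ /imsetP[x _ ->]; rewrite cards1.
have pd : @path_decomposition (quotient P) [:: [set: _]].
  split=> //.
  - by move=> x; exists ([set: quotient P]); rewrite !inE.
  - by move=> x y _; exists ([set: quotient P]); rewrite !inE.
  - by move=> x [|i] [|j] [|l] //; rewrite inE.
apply: inhabits; apply: (@PPD k G S X _ P partP wP _ pd).
  exact: subsetT.
move=> C /maxsetp/andP[CT /andP[/set0Pn[x xC] _]].
by have := subsetP CT _ xC; rewrite !inE.
Qed.

Lemma ppwP : (0 < k)%N ->
  (exists D : ppd k S, ppd_width D = ppw k S) /\
  forall D : ppd k S, ppw k S <= ppd_width D.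
Proof.
move=> k0; have [D0] := ppd_exists k0.
pose sz (D : ppd k S) := \max_(B <- ppd_bags D) #|B|.
have [[D Dm] mmin] :=
  @minimum_natP (fun n => exists D, sz D = n) (ex_intro _ _ (ex_intro _ D0 erefl)).
suff [? h] : (fun w => (exists D : ppd k S, ppd_width D = w) /\
    forall y, (exists D : ppd k S, ppd_width D = y) -> w <= y) (ppw k S).
  by split=> // D'; apply: h; exists D'.
apply: minimumP; exists (ppd_width D).
split; first by exists D.
move=> _ [D' <-]; rewrite /ppd_width /pd_width lerD2r lez_nat.
by rewrite -/(sz D) -/(sz D') Dm; apply: mmin; exists D'.
Qed.

End PpwMin.

(* Main.v *)
Require Import Defs.
From mathcomp Require Import all_boot all_order all_algebra.
From mathcomp Require Import boolp.

(**
  A graph without an [S]-rooted model of a tree on [t] vertices has an "[S]-rooted"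
  path-decomposition with bags of size at most [2t - 1]: as in Diestel's proof of the
  path-width theorem, a model of a growing subtree is pushed along a nested sequence of
  vertex sets by Menger's theorem, except that the branch sets are connected to [S] only
  at the very end. Such a decomposition yields an Erdős-Pósa property: a family of
  connected sets that all meet [S] has [d + 1] disjoint members or a hitting set of size
  at most [(2t - 1) d].

  Induct on the height [h] of the complete [d]-ary tree. Let [A] be a connected set.
  Among the connected sets outside [A] that contain an [S]-rooted [d]-ary tree of height
  [h] attached to [A] there are no [d + 1] disjoint ones: with [d] of them, and the last
  one absorbed into [A] to root it, [A] would give a tree of height [h + 1]. So they have
  a small hitting set, which is the next part. The pieces between two consecutive parts
  are decomposed by induction, and the two parts are added to all their bags: this costs
  two parts per level, whence the width [2h - 1].
*)

Set Implicit Arguments.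
Unset Strict Implicit.
Unset Printing Implicit Defensive.

Lemma disjoint_setP (T : finType) (A B : {set T}) :
  reflect (forall x, x \in A -> x \in B -> False) [disjoint A & B].
Proof.
apply: (iffP idP) => [dAB x xA xB|h].
  by rewrite (disjointFr dAB xA) in xB.
by rewrite -setI_eq0; apply/eqP/setP => x; rewrite !inE; apply/negP => /andP[]; apply: h.
Qed.

(** * Connected vertex sets *)

Section ConnectedSets.
Variable G : sgraph.
Implicit Types (W U X Y Z A F : {set G}) (x y u v : G).

Lemma connected_closed W Z x : connected_set W -> x \in W -> x \in Z ->
  (forall u v, u \in W -> v \in W -> adj u v -> u \in Z -> v \in Z) -> W \subset Z.
Proof.
case/andP=> _ /forall_inP cW xW xZ clZ; apply/subsetP => y yW.
have /connectP[p pth ->] := forall_inP (cW x xW) y yW.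
elim: p x xZ {xW} pth => //= v p IH x xZ /andP[/and3P[xW vW axv]].
by apply: IH; apply: clZ xZ.
Qed.

(** Connectedness becomes an induction principle: with [connected_closed] it turns each union
    argument below into a closure argument, without handling paths. *)
Lemma connected_intro W x : x \in W ->
  (forall Z : {set G}, x \in Z ->
    (forall u v, u \in W -> v \in W -> adj u v -> u \in Z -> v \in Z) ->
    W \subset Z) ->
  connected_set W.
Proof.
move=> xW hW; apply/andP; split; first by apply/set0Pn; exists x.
set r := [rel u v | [&& u \in W, v \in W & adj u v]].
have rsym : connect_sym r.
  by apply: sym_connect_sym => u v /=; rewrite adj_sym andbCA.
have hx : forall y, y \in W -> connect r x y.
  move=> y yW; suff /subsetP/(_ y yW) : W \subset [set z | connect r x z].
    by rewrite inE.
  apply: hW; rewrite ?inE ?connect0 // => u v uW vW auv; rewrite !inE => xu.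
  by apply: connect_trans xu (connect1 _); rewrite /= uW vW.
apply/forall_inP => y yW; apply/forall_inP => z zW.
by apply: connect_trans (hx z zW); rewrite rsym hx.
Qed.

Lemma connected_neq0 W : connected_set W -> exists x, x \in W.
Proof. by case/andP=> /set0Pn. Qed.

Lemma connected1 x : connected_set [set x].
Proof.
by apply: (@connected_intro _ x); rewrite ?inE // => Z xZ _; rewrite sub1set.
Qed.

Lemma connectedU W U x : connected_set W -> connected_set U -> x \in W -> x \in U ->
  connected_set (W :|: U).
Proof.
move=> cW cU xW xU; apply: (@connected_intro _ x); first by rewrite inE xW.
move=> Z xZ clZ; rewrite subUset.
by apply/andP; split; [apply: (connected_closed cW xW xZ)|apply: (connected_closed cU xU xZ)]
  => u v uW vW; apply: clZ; rewrite inE ?uW ?vW ?orbT.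
Qed.

Lemma connectedU_adj W U x y : connected_set W -> connected_set U ->
  x \in W -> y \in U -> adj x y -> connected_set (W :|: U).
Proof.
move=> cW cU xW yU axy; apply: (@connected_intro _ x); first by rewrite inE xW.
move=> Z xZ clZ; rewrite subUset.
have yZ : y \in Z by apply: clZ axy xZ; rewrite inE ?xW ?yU ?orbT.
by apply/andP; split; [apply: (connected_closed cW xW xZ)|apply: (connected_closed cU yU yZ)]
  => u v uW vW; apply: clZ; rewrite inE ?uW ?vW ?orbT.
Qed.

Lemma connected_star A U : connected_set A ->
  (forall v, v \in U -> exists F, [/\ connected_set F, F \subset A :|: U,
     v \in F & exists2 a, a \in F & a \in A]) ->
  connected_set (A :|: U).
Proof.
move=> cA hU; have [x xA] := connected_neq0 cA.
apply: (@connected_intro _ x); first by rewrite inE xA.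
move=> Z xZ clZ.
have /subsetP AZ : A \subset Z.
  by apply: (connected_closed cA xA xZ) => u v uW vW; apply: clZ; rewrite inE ?uW ?vW.
apply/subsetP => v; rewrite inE => /orP[/AZ //|/hU[F [cF /subsetP FU vF [a aF aA]]]].
suff /subsetP : F \subset Z by apply.
apply: (connected_closed cF aF (AZ a aA)) => u w /FU uU /FU wU; exact: clZ.
Qed.

End ConnectedSets.

(** * Menger's theorem between nested vertex sets *)

Section Linkage.
Variable G : sgraph.
Implicit Types (e : rel G) (B X Y Z : {set G}) (x y u v : G).

(* B is a set of sinks: its vertices count as having a neighbour outside every set. *)
Definition boundary e B Z : {set G} :=
  [set z in Z | (z \in B) || [exists w, (w \notin Z) && e z w]].

Lemma boundaryP e B Z z :
  reflect (z \in Z /\ (z \in B \/ exists2 w, w \notin Z & e z w)) (z \in boundary e B Z).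
Proof.
rewrite inE; apply: (iffP andP) => -[zZ h]; split=> //.
  by case/orP: h => [|/existsP[w /andP[? ?]]]; [left|right; exists w].
case: h => [->//|[w ? ?]]; apply/orP; right; apply/existsP; exists w.
by apply/andP.
Qed.

Lemma boundary_sub e B Z : boundary e B Z \subset Z.
Proof. by apply/subsetP => z /boundaryP[]. Qed.

(** The connected sets [g x] stand for disjoint paths between the two boundaries. Each meets [X]
    only in its start [x], so it can prolong a branch set lying inside [X]. *)
Definition linked e B X Y := exists g : G -> {set G},
  (forall x, x \in boundary e B X -> [/\ x \in g x, connected_set (g x),
     g x \subset x |: (Y :\: X) & exists2 y, y \in g x & y \in boundary e B Y]) /\
  (forall x x', x \in boundary e B X -> x' \in boundary e B X -> x != x' ->
     [disjoint g x & g x']).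

(** The two linkages are concatenated at a vertex [z x] of the boundary of [Z]. First pieces lie in
    [Z] and second pieces meet [Z] only in their start, so a clash between different pieces would
    already occur in the first linkage or in the second. *)
Lemma linked_trans e B X Z Y : X \subset Z -> Z \subset Y ->
  linked e B X Z -> linked e B Z Y -> linked e B X Y.
Proof.
move=> /subsetP XZ /subsetP ZY [g [g1 g2]] [k [k1 k2]].
have ex x : exists z, x \in boundary e B X -> z \in g x /\ z \in boundary e B Z.
  case: (boolP (x \in boundary e B X)) => [xX|_]; last by exists x.
  by have [_ _ _ [z zg zZ]] := g1 _ xX; exists z.
have [z zP] := choice ex.
have gZ x : x \in boundary e B X -> {subset g x <= Z}.
  move=> xX; have [_ _ /subsetP gs _] := g1 _ xX.
  move=> u /gs; rewrite !inE => /orP[/eqP->|/andP[]//].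
  by apply: XZ; case/boundaryP: xX.
have kint x x' u : x \in boundary e B X -> x' \in boundary e B X ->
    u \in g x -> u \in k (z x') -> u = z x'.
  move=> xX x'X ug uk; have [_ /k1[_ _ /subsetP ks _]] := zP _ x'X.
  by move: (ks _ uk); rewrite !inE (gZ x xX u ug) /= orbF => /eqP.
exists (fun x => g x :|: k (z x)); split.
  move=> x xX; have [xg cg /subsetP gs _] := g1 _ xX.
  have [zg zZ] := zP _ xX; have [zk ck /subsetP ks [y yk yY]] := k1 _ zZ.
  split.
  - by rewrite inE xg.
  - exact: connectedU cg ck zg zk.
  - apply/subsetP => u; rewrite inE => /orP[/gs|/ks]; rewrite !inE.
      by case/orP=> [->//|/andP[-> /ZY->]]; rewrite orbT.
    case/orP=> [/eqP->|/andP[uZ ->]].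
      move: (gs _ zg); rewrite !inE.
      by case/orP=> [->//|/andP[-> /ZY->]]; rewrite orbT.
    by rewrite andbT (contra (XZ u)) ?orbT.
  - by exists y; rewrite // inE yk orbT.
move=> x x' xX x'X nxx'; have [zg zZ] := zP _ xX; have [zg' zZ'] := zP _ x'X.
have dg := disjoint_setP _ _ (g2 _ _ xX x'X nxx').
apply/disjoint_setP => u; rewrite !inE => /orP[] ux /orP[] ux'.
- exact: (dg u).
- by have uz := kint _ _ _ xX x'X ux ux'; apply: (dg u); rewrite // uz.
- by have uz := kint _ _ _ x'X xX ux' ux; apply: (dg u); rewrite // uz.
- suff nz : z x != z x' by apply: (disjoint_setP _ _ (k2 _ _ zZ zZ' nz) u).
  by apply/eqP => ez; apply: (dg (z x)); rewrite // ez.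
Qed.

(* Menger's theorem for nested sets; the induction deletes edges, hence the subrelation e
   of adj. *)
Lemma linkage e B X Y : subrel e (@adj G) -> X \subset Y ->
  (forall Z, X \subset Z -> Z \subset Y -> #|boundary e B X| <= #|boundary e B Z|) ->
  linked e B X Y.
Proof.
have [m] := ubnP (#|[set p | e p.1 p.2]| + #|Y :\: X|).
elim: m e X Y => // m IH e X Y; rewrite ltnS => ltm eadj sXY minX.
have [sbd|] := boolP (boundary e B X \subset boundary e B Y).
  exists (fun x => [set x]); split.
    move=> x xX; split; rewrite ?inE ?connected1 ?sub1set ?inE ?eqxx //.
    by exists x; rewrite ?set11 // (subsetP sbd).
  by move=> x x' _ _ nxx'; rewrite disjoints1 inE.
case/subsetPn=> x xX xnY.
(* A proper intermediate [Z] whose boundary is as small as that of [X] splits the problem into two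
   smaller ones. *)
have [[Z [sXZ sZY nXZ nZY eZ]]|noZ] := pselect (exists Z, [/\ X \subset Z,
    Z \subset Y, X != Z, Z != Y & #|boundary e B Z| <= #|boundary e B X|]).
  have XZ : X \proper Z by rewrite properEneq nXZ.
  have ZY : Z \proper Y by rewrite properEneq nZY.
  apply: (linked_trans sXZ sZY); apply: IH => //.
  - apply: leq_trans ltm; rewrite ltn_add2l; apply: proper_card.
    rewrite properE setSD //=; case/properP: ZY => _ [y yY yZ].
    apply/subsetPn; exists y; rewrite !inE ?(negPf yZ) ?andbF // yY andbT.
    by apply: contra yZ; apply: (subsetP sXZ).
  - by move=> U sXU sUZ; apply: minX => //; apply: subset_trans sZY.
  - apply: leq_trans ltm; rewrite ltn_add2l; apply: proper_card.
    rewrite properE setDS //=; case/properP: XZ => _ [y yZ yX].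
    by apply/subsetPn; exists y; rewrite !inE ?yZ // yX (subsetP sZY).
  - move=> U sZU sUY; apply: leq_trans eZ (minX _ _ _) => //.
    exact: subset_trans sZU.
(* Now every proper intermediate set has a strictly larger boundary and can afford to lose one
   vertex. *)
have gtZ Z : X \subset Z -> Z \subset Y -> X != Z -> Z != Y ->
    #|boundary e B X| < #|boundary e B Z|.
  by move=> *; rewrite ltnNge; apply/negP => ?; apply: noZ; exists Z.
have [xinX xcase] := boundaryP _ _ _ _ xX.
have xinY := subsetP sXY _ xinX.
have xout w : e x w -> w \in Y.
  by move=> exw; apply: contraR xnY => wY; apply/boundaryP; split=> //; right; exists w.
have [xB|[y yX exy]] := xcase.
  by case/boundaryP: xnY; split=> //; left.
have yY := xout _ exy.
(* If [x] has a second neighbour [y'] outside [X], the edge from [x] to [y] can be deleted: the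
   boundaries of [X] and [Y] do not change, and any other boundary loses at most [x]. *)
have [[y' [y'X exy' ny]]|uniqy] :=
  pselect (exists y', [/\ y' \notin X, e x y' & y' != y]).
  pose e' := [rel u v | e u v && ((u, v) != (x, y))].
  have e'e : subrel e' e by move=> u v /andP[].
  have bd'sub Z : boundary e' B Z \subset boundary e B Z.
    apply/subsetP => u /boundaryP[uZ h]; apply/boundaryP; split=> //.
    by case: h => [|[w wZ /e'e]]; [left|right; exists w].
  have bd'X : boundary e' B X = boundary e B X.
    apply/eqP; rewrite eqEsubset bd'sub; apply/subsetP => u /boundaryP[uX h].
    apply/boundaryP; split=> //; case: h => [|[w wX euw]]; first by left.
    right; have [->|nux] := eqVneq u x.
      by exists y'; rewrite //= exy' xpair_eqE (negPf ny) andbF.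
    by exists w; rewrite //= euw xpair_eqE (negPf nux).
  have bd'Y : boundary e B Y \subset boundary e' B Y.
    apply/subsetP => u /boundaryP[uY h]; apply/boundaryP; split=> //.
    case: h => [|[w wY euw]]; first by left.
    right; exists w; rewrite //= euw xpair_eqE; apply/negP => /andP[_ /eqP wy].
    by rewrite wy yY in wY.
  have bd'Z Z : X \subset Z -> Z \subset Y -> #|boundary e' B X| <= #|boundary e' B Z|.
    move=> sXZ sZY; rewrite bd'X.
    have [<-|nXZ] := eqVneq X Z; first by rewrite bd'X.
    have [->|nZY] := eqVneq Z Y.
      by apply: leq_trans (subset_leq_card bd'Y); apply: minX.
    rewrite -ltnS; apply: leq_trans (gtZ Z sXZ sZY nXZ nZY) _.
    have sb : boundary e B Z \subset x |: boundary e' B Z.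
      apply/subsetP => u /boundaryP[uZ h]; rewrite !inE uZ /=.
      have [//|nux /=] := eqVneq u x; case: h => [->//|[w wZ euw]].
      apply/orP; right; apply/existsP; exists w.
      by rewrite wZ /= euw xpair_eqE (negPf nux).
    apply: leq_trans (subset_leq_card sb) _.
    by rewrite cardsU1 -add1n leq_add2r leq_b1.
  have [||g [g1 g2]] := IH e' X Y _ _ sXY bd'Z.
  - apply: leq_trans ltm; rewrite ltn_add2r; apply: proper_card.
    rewrite properE; apply/andP; split.
      by apply/subsetP => p; rewrite !inE => /andP[].
    by apply/subsetPn; exists (x, y); rewrite !inE //= eqxx andbF.
  - by move=> u v /e'e/eadj.
  - exists g; split=> [u|u v]; rewrite -bd'X; last exact: g2.
    move=> uX; have [a b c [w wg wY]] := g1 _ uX; split=> //.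
    by exists w; rewrite // (subsetP (bd'sub Y)).
(* Otherwise [y] is the only way out of [X] from [x]. Adding [y] to [X] trades [x] for [y] in the
   boundary, so by strictness [y |: X] is all of [Y]. *)
have sub1 : boundary e B (y |: X) \subset y |: (boundary e B X :\ x).
  apply/subsetP => u /boundaryP[]; rewrite !inE => /orP[->//|uX] h.
  have [//|nuy /=] := eqVneq u y; rewrite uX /=; case: h => [uB|[w]].
    rewrite uB /= andbT; apply/eqP => ux; case/boundaryP: xnY; split=> //; left.
    by rewrite -ux.
  rewrite !inE negb_or => /andP[nwy wX] euw; apply/andP; split.
    by apply/eqP => ux; apply: uniqy; exists w; split=> //; rewrite -ux.
  by apply/orP; right; apply/existsP; exists w; rewrite wX.
have card1 : #|y |: (boundary e B X :\ x)| <= #|boundary e B X|.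
  rewrite (cardsD1 x (boundary e B X)) xX cardsU1 leq_add2r; exact: leq_b1.
have sX1 : X \subset y |: X by apply: subsetUr.
have s1Y : y |: X \subset Y by rewrite subUset sub1set yY.
have e1Y : y |: X = Y.
  apply/eqP; apply: contraT => n1Y.
  have nX1 : X != y |: X.
    by apply: contra yX => /eqP->; rewrite !inE eqxx.
  have := gtZ _ sX1 s1Y nX1 n1Y.
  by rewrite ltnNge (leq_trans (subset_leq_card sub1) card1).
rewrite e1Y in sub1.
have bdY : boundary e B Y = y |: (boundary e B X :\ x).
  apply/eqP; rewrite eqEcard sub1; apply: leq_trans card1 (minX _ _ _) => //.
exists (fun u => if u == x then [set x; y] else [set u]); split.
  move=> u uX; have [->|nux] := eqVneq u x.
    split; rewrite ?inE ?eqxx //.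
    - by apply: (connectedU_adj (connected1 x) (connected1 y) (set11 x) (set11 y)); apply: eadj.
    - by rewrite subUset !sub1set !inE eqxx yX yY orbT.
    - by exists y; rewrite ?bdY !inE eqxx ?orbT.
  split; rewrite ?inE ?connected1 ?sub1set ?inE ?eqxx //.
  by exists u; rewrite ?set11 // bdY in_setU1 in_setD1 nux uX orbT.
have ny u : u \in boundary e B X -> u != y.
  by case/boundaryP=> uX _; apply: contraNneq yX => <-.
move=> u v uX vX nuv; apply/disjoint_setP => w.
case: (eqVneq u x) => [ux|nux]; case: (eqVneq v x) => [vx|nvx]; rewrite !inE.
- by rewrite ux vx eqxx in nuv.
- move=> h /eqP wv; move: h; rewrite wv (negPf nvx) /=.
  by rewrite (negPf (ny _ vX)).
- by move=> /eqP-> ; rewrite (negPf nux) (negPf (ny _ uX)).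
- by move=> /eqP->; rewrite (negPf nuv).
Qed.

End Linkage.

(** * Rooted path-decompositions and their Erdős-Pósa property *)

Local Notation border := (boundary (@adj _) set0).

Section Chains.
Variables (G : sgraph) (S : {set G}) (n : nat).
Implicit Types (W X Y Z K L F : {set G}) (s x y u v : G).

Lemma borderP Z z :
  reflect (z \in Z /\ exists2 w, w \notin Z & adj z w) (z \in border Z).
Proof.
apply: (iffP (boundaryP _ _ _ _)) => -[zZ h]; split=> //; last by right.
by case: h => //; rewrite inE.
Qed.

(* A path-decomposition of (G, S), given by its adhesion sets: the bag of a step from
   (X, K) to (Y, L) consists of K, L and the vertices of S in Y minus X, and the vertices
   of Y minus X outside this bag need not be covered. *)
Inductive chain : {set G} -> {set G} -> Prop :=
| Chain0 : chain set0 set0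
| ChainS X K Y L : chain X K -> X \subset Y -> border Y \subset L -> L \subset Y ->
    #|L| <= n -> #|(S :&: (Y :\: X)) :\: L| <= 1 -> chain Y L.

Definition good Y := exists L, chain Y L.

Lemma chain_border X K : chain X K -> border X \subset K.
Proof.
by case=> // ; apply/subsetP => x /borderP[]; rewrite inE.
Qed.

Lemma chain_card X K : chain X K -> #|K| <= n.
Proof. by case=> //; rewrite cards0. Qed.

Lemma good0 : good set0.
Proof. by exists set0; apply: Chain0. Qed.

Lemma good_step X Y L : good X -> X \subset Y -> border Y \subset L -> L \subset Y ->
  #|L| <= n -> #|(S :&: (Y :\: X)) :\: L| <= 1 -> good Y.
Proof. by case=> K cK *; exists L; apply: ChainS cK _ _ _ _ _. Qed.

Lemma good_step1 X y : good X -> #|border (y |: X)| <= n -> good (y |: X).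
Proof.
move=> gX cb; apply: (good_step gX (subsetUr _ _) (subxx _) (boundary_sub _ _ _) cb).
rewrite -(cards1 y); apply: subset_leq_card; apply/subsetP => u.
rewrite in_setD in_setI in_setD in_setU1 in_set1.
by case: eqP => //= _; case: (u \in X); rewrite ?andbF.
Qed.

(* Submodularity of the border: the pair (X, K) is replaced by its meet with (Z, border Z),
   and the minimality of the border of Z bounds the order of the join from below. *)
Lemma chain_cut Y Z : Z \subset Y ->
  (forall W, Z \subset W -> W \subset Y -> #|border Z| <= #|border W|) ->
  forall X K, chain X K -> X \subset Y ->
  chain (X :&: Z) ((K :&: Z) :|: (X :&: border Z)).
Proof.
move=> sZY minZ X K; elim=> [_|{}X {}K X' K' c IH sX bX' KX' cK' sS sX'Y].
  by rewrite !set0I setU0; apply: Chain0.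
have sXY := subset_trans sX sX'Y.
apply: ChainS (IH sXY) _ _ _ _ _.
- exact: setSI.
- apply/subsetP => u /borderP[]; rewrite inE => /andP[uX' uZ] [w].
  rewrite !in_setU !in_setI uZ uX' andbT negb_and => /orP[wX'|wZ] auw.
    by rewrite (subsetP bX') //; apply/borderP; split=> //; exists w.
  by apply/orP; right; apply/borderP; split=> //; exists w.
- rewrite subUset setSI //; apply: setIS; exact: boundary_sub.
(* [J] is the adhesion set of the join of [X'] and [Z]. The adhesion sets of meet and join together
   have size at most [#|K'| + #|border Z|], and [J] has size at least [#|border Z|] because it
   contains the border of [X' :|: Z]. *)
- set J := (K' :\: Z) :|: ((border Z :\: X') :|: (K' :&: border Z)).
  have bJ : border (X' :|: Z) \subset J.
    apply/subsetP => u /borderP[]; rewrite inE => uXZ [w].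
    rewrite in_setU negb_or => /andP[wX' wZ] auw.
    have h1 : u \in X' -> u \in K'.
      by move=> uX'; apply: (subsetP bX'); apply/borderP; split=> //; exists w.
    have h2 : u \in Z -> u \in border Z.
      by move=> uZ; apply/borderP; split=> //; exists w.
    rewrite /J !in_setU !in_setD in_setI; move: uXZ.
    have [uX|_] := boolP (u \in X'); have [uZ|_] := boolP (u \in Z) => //= _.
    - by rewrite h1 // h2 // orbT.
    - by rewrite h1.
    - by rewrite h2 // orbT.
  have cJ : #|border Z| <= #|J|.
    apply: leq_trans (subset_leq_card bJ); apply: minZ; first exact: subsetUr.
    by rewrite subUset sX'Y.
  have e1 : #|K' :&: Z| + #|K' :\: Z| = #|K'| by apply: cardsID.
  have e2 : #|X' :&: border Z| + #|border Z :\: X'| = #|border Z|.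
    by rewrite setIC; apply: cardsID.
  have e3 : #|(K' :&: Z) :|: (X' :&: border Z)| + #|K' :&: border Z|
            = #|K' :&: Z| + #|X' :&: border Z|.
    have e : K' :&: Z :&: (X' :&: border Z) = K' :&: border Z.
      apply/setP => u; rewrite !in_setI.
      case uK: (u \in K') => //=; rewrite (subsetP KX' _ uK) /=.
      by case ub: (u \in border Z); rewrite ?andbF // (subsetP (boundary_sub _ _ _) _ ub).
    rewrite cardsU e subnK // -e; apply: leq_trans (leq_addr _ _).
    by apply: subset_leq_card; apply: subsetIl.
  have e4 : #|J| <= #|K' :\: Z| + (#|border Z :\: X'| + #|K' :&: border Z|).
    rewrite /J; apply: leq_trans (leq_card_setU _ _) _; rewrite leq_add2l.
    exact: leq_card_setU.
  apply: leq_trans cK'.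
  rewrite -(leq_add2r #|K' :&: border Z|) e3 -(leq_add2r #|border Z :\: X'|) -addnA e2.
  apply: leq_trans (leq_add (leqnn _) cJ) _.
  apply: leq_trans (leq_add (leqnn _) e4) _.
  by rewrite addnA e1 addnA addnAC.
- apply: leq_trans sS; apply: subset_leq_card; apply/subsetP => u.
  rewrite !in_setD !in_setI !in_setD !in_setU !in_setI.
  by case: (u \in S); case: (u \in X'); case: (u \in X); case: (u \in Z);
    case: (u \in K'); rewrite ?orbT ?andbF.
Qed.

Lemma good_cut Y Z : good Y -> Z \subset Y ->
  (forall W, Z \subset W -> W \subset Y -> #|border Z| <= #|border W|) -> good Z.
Proof.
move=> [L cL] sZY minZ; have := chain_cut sZY minZ cL (subxx _).
by rewrite (setIidPr sZY); eexists; eassumption.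
Qed.

Lemma connected_border F Z : connected_set F -> [disjoint F & border Z] ->
  F \subset Z \/ [disjoint F & Z].
Proof.
move=> cF /disjoint_setP dF.
have [[x xF xZ]|no] := pselect (exists2 x, x \in F & x \in Z).
  left; apply: (connected_closed cF xF xZ) => u v uF vF auv uZ.
  by apply: contraT => vZ; case: (dF u) => //; apply/borderP; split=> //; exists v.
by right; apply/disjoint_setP => x xF xZ; apply: no; exists x.
Qed.

Definition rooted_family (Fam : {set G} -> Prop) :=
  forall F, Fam F -> connected_set F /\ exists2 s, s \in F & s \in S.

(** Let [Y] be the first set of the chain that contains a member [F], and let [K'] be the bag of the
    step from [X] to [Y]. A member avoiding [K'] crosses neither border. If it lay in [Y], it would
    be disjoint from [X] by the choice of [Y], and its vertex of [S] would be in the bag. So it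
    misses [Y], and with it [F]. *)
Lemma first_bag Fam X K : rooted_family Fam -> chain X K ->
  (exists2 F, Fam F & F \subset X) ->
  exists F K', [/\ Fam F, #|K'| <= n.*2.+1 &
    forall F', Fam F' -> [disjoint F' & K'] -> [disjoint F' & F]].
Proof.
move=> rF; elim=> [|{}X {}K Y L c IH sXY bY LY cL sS] [F FF sF].
  have [/connected_neq0[x xF] _] := rF F FF.
  by have := subsetP sF _ xF; rewrite inE.
have [exX|noX] := pselect (exists2 F, Fam F & F \subset X); first exact: IH.
exists F, ((S :&: (Y :\: X)) :\: L :|: (K :|: L)); split=> //.
  apply: leq_trans (leq_card_setU _ _) _; rewrite -add1n leq_add //.
  apply: leq_trans (leq_card_setU _ _) _; rewrite -addnn leq_add //.
  exact: chain_card c.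
move=> F' FF' /disjoint_setP dF'; have [cF' [s sF' sSs]] := rF F' FF'.
have [|F'Y|dY] := @connected_border F' Y cF'.
- apply/disjoint_setP => u uF' /(subsetP bY) uL; apply: (dF' u) => //.
  by rewrite !in_setU uL !orbT.
- have [|F'X|dX] := @connected_border F' X cF'.
  + apply/disjoint_setP => u uF' /(subsetP (chain_border c)) uK; apply: (dF' u) => //.
    by rewrite !in_setU uK !orbT.
  + by case: noX; exists F'.
  + case: (dF' s) => //; rewrite !in_setU in_setD in_setI in_setD sSs.
    rewrite (disjointFr dX sF') (subsetP F'Y) //=; case: (s \in L) => //=.
    by rewrite orbT.
- by apply: disjointWr sF dY.
Qed.

(** Greedy choice: take the member and the bag given by [first_bag], then recurse on the members
    avoiding this bag, all of which are disjoint from the chosen one. *)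
Lemma erdos_posa Fam k : good [set: G] -> rooted_family Fam ->
  (exists Fs : seq {set G}, [/\ size Fs = k.+1, forall F, F \in Fs -> Fam F &
     pairwise (fun A B : {set G} => [disjoint A & B]) Fs]) \/
  exists2 K : {set G}, #|K| <= k * n.*2.+1 &
    forall F, Fam F -> ~~ [disjoint F & K].
Proof.
move=> [L cL]; elim: k Fam => [|k IH] Fam rF.
  have [[F FF]|no] := pselect (exists F, Fam F).
    by left; exists [:: F]; split=> // F'; rewrite inE => /eqP->.
  by right; exists set0; rewrite ?cards0 // => F FF; case: no; exists F.
have [[F FF]|no] := pselect (exists F, Fam F); last first.
  by right; exists set0; rewrite ?cards0 // => F FF; case: no; exists F.
have [|F0 [K [FF0 cK dK]]] := first_bag rF cL; first by exists F; rewrite ?subsetT.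
pose Fam' F := Fam F /\ [disjoint F & K].
have rF' : rooted_family Fam' by move=> F' [/rF].
have [[Fs [sFs aFs pFs]]|[K' cK' hK']] := IH _ rF'.
  left; exists (F0 :: Fs); split=> /=; first by rewrite sFs.
    by move=> F'; rewrite inE => /orP[/eqP->|/aFs[]].
  rewrite pFs andbT; apply/allP => F' /aFs[FF' dF'].
  by rewrite disjoint_sym; apply: dK.
right; exists (K :|: K').
  by apply: leq_trans (leq_card_setU _ _) _; rewrite mulSn leq_add.
move=> F' FF'; apply/negP => d.
have [d1 d2] : [disjoint F' & K] /\ [disjoint F' & K'].
  by split; apply: disjointWr d; rewrite ?subsetUl ?subsetUr.
by have := hK' F' (conj FF' d1); rewrite d2.
Qed.

End Chains.

(** * Growing a subtree vertex by vertex *)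

Lemma acyclic_attach (T : sgraph) (F : {set T}) (v u1 u2 : T) :
  acyclic T -> connected_set F -> v \notin F -> u1 \in F -> u2 \in F ->
  adj v u1 -> adj v u2 -> u1 = u2.
Proof.
move=> acT /andP[_ /forall_inP cF] vF u1F u2F a1 a2; apply: contrapT => /eqP n12.
have /connectP[p0 pth lst] := forall_inP (cF _ u1F) _ u2F.
case/shortenP: pth lst => p pth up _ lst.
have [pa pF] : path (@adj T) u1 p /\ {subset p <= F}.
  elim: p u1 {u1F a1 n12 p0 up lst} pth => //= z p IH u1 /andP[/and3P[_ zF az] /IH[-> sp]].
  by rewrite az; split=> // w; rewrite inE => /orP[/eqP->|/sp].
(* The path inside [F] closes up through [v] to a cycle, which is too long unless [u1 = u2]. *)
have /acT : ucycle (@adj T) [:: v, u1 & p].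
  apply/andP; split.
    by rewrite /= a1 rcons_path pa -lst adj_sym a2.
  rewrite cons_uniq up andbT inE negb_or; apply/andP; split.
    by apply: contraNneq vF => ->.
  by apply: contra vF => /pF.
by case: p lst {pth up pa pF} => // lst; rewrite lst eqxx in n12.
Qed.

(** The new vertex has at most one neighbour in [W], so that extending a model by it requires at
    most one new adjacency. The empty [W] is allowed in order to start the process. *)
Lemma tree_grow (T : sgraph) (W : {set T}) : is_tree T ->
  W = set0 \/ connected_set W -> W != setT ->
  exists v, [/\ v \notin W, connected_set (v |: W),
    W = set0 \/ (exists2 w, w \in W & adj v w) &
    forall w w', w \in W -> w' \in W -> adj v w -> adj v w' -> w = w'].
Proof.
move=> [cT acT] [->|cW] nW.
  have [v _] := connected_neq0 cT; exists v; split; rewrite ?inE ?setU0 ?connected1 //.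
    by left.
  by move=> w w'; rewrite inE.
have [w0 w0W] := connected_neq0 cW.
have [[v [w [vW wW avw]]]|no] :=
  pselect (exists v w, [/\ v \notin W, w \in W & adj v w]).
  exists v; split=> //.
  - exact: connectedU_adj (connected1 v) cW (set11 v) wW avw.
  - by right; exists w.
  - by move=> u u' uW u'W; apply: acyclic_attach acT cW vW uW u'W.
case/negP: nW; rewrite -subTset; apply: (connected_closed cT _ w0W); rewrite ?inE //.
move=> u v _ _ auv uW; apply: contraT => vW; case: no; exists v, u; split=> //.
by rewrite adj_sym.
Qed.

(** * Models of a subtree and their extension *)

Section PartialModels.
Variables (G T : sgraph).
Implicit Types (W : {set T}) (X : {set G}).

Definition partial_model W (f : T -> {set G}) :=
  [/\ forall w, w \in W -> connected_set (f w),
      forall w w', w \in W -> w' \in W -> w != w' -> [disjoint f w & f w'] &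
      forall w w', w \in W -> w' \in W -> adj w w' ->
        exists x y, [/\ x \in f w, y \in f w' & adj x y]].

(** Each branch set is prolonged from its end [b w] on the border by a connected set that otherwise
    avoids [X], and the set starting at [y] is the branch set of [v]. *)
Lemma partial_model_extend W X f (b : T -> G) v y (g : G -> {set G}) :
  partial_model W f ->
  (forall w, w \in W -> [/\ f w \subset X, b w \in f w & b w \in border X]) ->
  v \notin W -> y \notin X -> (forall w, w \in W -> adj v w -> adj (b w) y) ->
  (forall u, u \in y |: border X ->
     [/\ u \in g u, connected_set (g u) & g u \subset u |: ~: (y |: X)]) ->
  (forall u u', u \in y |: border X -> u' \in y |: border X -> u != u' ->
     [disjoint g u & g u']) ->
  partial_model (v |: W) (fun w => if w == v then g y else f w :|: g (b w)).
Proof.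
move=> [f1 f2 f3] fb vW yX vy g1 g2.
have nv w : w \in W -> (w == v) = false.
  by move=> wW; apply/negP => /eqP wv; rewrite -wv wW in vW.
have bin w : w \in W -> b w \in y |: border X.
  by case/fb=> _ _ bX; rewrite in_setU1 bX orbT.
have yin : y \in y |: border X by rewrite in_setU1 eqxx.
have bX w : w \in W -> b w \in X.
  by case/fb=> _ _; apply: (subsetP (boundary_sub _ _ _)).
have yb w : w \in W -> b w != y by move/bX; apply: contraTneq => ->.
have [yg cgy /subsetP sgy] := g1 _ yin.
have gyX u : u \in g y -> u \in X -> False.
  move=> /sgy; rewrite !inE => /orP[/eqP->|]; first by rewrite (negPf yX).
  by rewrite negb_or => /andP[_ /negPf->].
have gbX w u : w \in W -> u \in g (b w) -> u \in X -> u = b w.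
  move=> wW; have [_ _ /subsetP sg] := g1 _ (bin _ wW).
  move=> /sg; rewrite !inE => /orP[/eqP->//|].
  by rewrite negb_or => /andP[_ /negPf->].
have dgW w : w \in W -> [disjoint g y & f w :|: g (b w)].
  move=> wW; apply/disjoint_setP => u uy; rewrite inE => /orP[uf|ub].
    by apply: (gyX u) => //; have [/subsetP fX _ _] := fb _ wW; apply: fX.
  by apply: (disjoint_setP _ _ (g2 _ _ yin (bin _ wW) _) u) => //; rewrite eq_sym yb.
have adjv w : w \in W -> adj v w ->
    exists x z, [/\ x \in g y, z \in f w :|: g (b w) & adj x z].
  move=> wW avw; exists y, (b w); split=> //; last by rewrite adj_sym vy.
  by have [_ bf _] := fb _ wW; rewrite inE bf.
split.
- move=> w; rewrite in_setU1; case: eqP => [_ _ //|_ /= wW].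
  have [bg cg _] := g1 _ (bin _ wW); have [_ bf _] := fb _ wW.
  exact: connectedU (f1 _ wW) cg bf bg.
- move=> w w'; rewrite !in_setU1 => /orP[/eqP->|wW] /orP[/eqP->|wW'] nww'.
  + by rewrite eqxx in nww'.
  + by rewrite eqxx nv // dgW.
  + by rewrite eqxx nv // disjoint_sym dgW.
  + rewrite !nv //; have df := disjoint_setP _ _ (f2 _ _ wW wW' nww').
    have [fX bf _] := fb _ wW; have [fX' bf' _] := fb _ wW'.
    apply/disjoint_setP => u; rewrite !inE => /orP[] u1 /orP[] u2.
    * exact: df u1 u2.
    * have ub := gbX _ _ wW' u2 (subsetP fX _ u1).
      by apply: (df u); rewrite // ub.
    * have ub := gbX _ _ wW u1 (subsetP fX' _ u2).
      by apply: (df u); rewrite // ub.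
    * apply: (disjoint_setP _ _ (g2 _ _ (bin _ wW) (bin _ wW') _) u) => //.
      by apply/eqP => eb; apply: (df (b w)); rewrite // eb.
- move=> w w'; rewrite !in_setU1 => /orP[/eqP->|wW] /orP[/eqP->|wW'] aw.
  + by rewrite adj_irrefl in aw.
  + by rewrite eqxx nv //; apply: adjv.
  + rewrite eqxx nv //; rewrite adj_sym in aw.
    have [x [z [xy zw axz]]] := adjv _ wW aw.
    by exists z, x; split=> //; rewrite adj_sym.
  + rewrite !nv //; have [x [z [xf zf axz]]] := f3 _ _ wW wW' aw.
    by exists x, z; split=> //; rewrite inE ?xf ?zf.
Qed.

End PartialModels.

(** * Excluding a rooted tree gives a rooted path-decomposition *)

Section RootedPathwidth.
Variables (G : sgraph) (S : {set G}) (n : nat).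
Implicit Types (X Y Z : {set G}).

Local Notation good := (good S n).

(** Maximality supplies the lower bound on borders that Menger's theorem needs: a good proper
    superset has a border of more than [i] vertices. *)
Definition maximal_good i X := [/\ good X, #|border X| <= i &
  forall Y, good Y -> X \subset Y -> #|border Y| <= i -> Y = X].

Lemma maximal_goodP i X0 : good X0 -> #|border X0| <= i ->
  exists2 X, maximal_good i X & X0 \subset X.
Proof.
move=> g0 c0; pose P Y := `[< good Y >] && (#|border Y| <= i).
have P0 : P X0 by rewrite /P c0 andbT; apply/asboolP.
have [X /maxsetP[/andP[/asboolP gX cX] mX] sX] := maxset_exists P0.
exists X => //; split=> // Y gY sXY cY; apply: mX => //.
by rewrite /P cY andbT; apply/asboolP.
Qed.

Lemma border_add X y : border (y |: X) \subset y |: border X.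
Proof.
apply/subsetP => u /borderP[]; rewrite !in_setU1 => /orP[->//|uX] [w].
rewrite in_setU1 negb_or => /andP[_ wX] auw; apply/orP; right.
by apply/borderP; split=> //; exists w.
Qed.

Variables (T : sgraph).
Hypotheses (T_tree : is_tree T) (T_card : #|T| = n.+1).
Hypothesis no_model : ~ exists M : model T G, rooted S M.

(* The branch sets need not meet S: a maximal good set is linked to the rest of S. *)
Definition transversal_model i :=
  exists (W : {set T}) (X : {set G}) (f : T -> {set G}) (b : T -> G),
  [/\ #|W| = i, W = set0 \/ connected_set W, maximal_good i X, partial_model W f &
      #|border X| = i /\
      forall w, w \in W -> [/\ f w \subset X, b w \in f w & b w \in border X]].

(** The branch set of the only neighbour of [v] in [W] ends on the border of [X], so this end has a
    neighbour [y] outside [X]. If [W] is empty, any vertex outside [X] will do. *)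
Lemma extension_point (W : {set T}) X (f : T -> {set G}) (b : T -> G) : X != setT -> W != setT ->
  W = set0 \/ connected_set W ->
  (forall w, w \in W -> [/\ f w \subset X, b w \in f w & b w \in border X]) ->
  exists v y, [/\ v \notin W, connected_set (v |: W), y \notin X &
    forall w, w \in W -> adj v w -> adj (b w) y].
Proof.
move=> nX nW cW fb; have [v [vW cvW hW uW]] := tree_grow T_tree cW nW.
exists v; case: hW => [W0|[w0 w0W avw0]].
  have [y _ yX] : exists2 y, y \in [set: G] & y \notin X.
    by apply/subsetPn; rewrite subTset.
  by exists y; split=> // w; rewrite W0 inE.
have [_ _ /borderP[_ [y yX aby]]] := fb _ w0W.
by exists y; split=> // w wW avw; rewrite -(uW w0 w).
Qed.

(** By the maximality of [X], every good set containing [y |: X] has a border of at least [i.+1]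
    vertices; adding [y] raises the border by at most one, so it is exactly [i.+1] both there and at
    a maximal good set [Y] above. *)
Lemma maximal_link i X y : i < n -> maximal_good i X -> #|border X| = i ->
  y \notin X ->
  exists Y, [/\ maximal_good i.+1 Y, #|border Y| = i.+1, y |: X \subset Y,
    border (y |: X) = y |: border X & linked (@adj G) set0 (y |: X) Y].
Proof.
move=> ltin [gX cX mX] eX yX.
have cy : #|y |: border X| = i.+1.
  by rewrite cardsU1 eX (contra (subsetP (boundary_sub _ _ _) y) yX).
have cX' : #|border (y |: X)| <= i.+1.
  by rewrite -cy; apply: subset_leq_card; apply: border_add.
have big Z : good Z -> y |: X \subset Z -> i < #|border Z|.
  move=> gZ sZ; rewrite ltnNge; apply/negP => cZ.
  have eZ := mX Z gZ (subset_trans (subsetUr _ _) sZ) cZ.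
  by move: (subsetP sZ y); rewrite setU11 eZ (negPf yX) => /(_ isT).
have gX' : good (y |: X) by apply: good_step1 => //; apply: leq_trans cX' ltin.
have [Y mY sY] := maximal_goodP gX' cX'.
have [gY cY _] := mY.
have eX' : border (y |: X) = y |: border X.
  by apply/eqP; rewrite eqEcard border_add cy big.
exists Y; split=> //; first by apply/eqP; rewrite eqn_leq cY big.
apply: linkage => // Z sZ1 sZ2; rewrite eX' cy.
(* [Z] need not be good, but a set of minimum border between [y |: X] and [Y] is, by [good_cut]. *)
pose P Z := (y |: X \subset Z) && (Z \subset Y).
have PZ : P Z by rewrite /P sZ1.
case: (arg_minnP (fun Z : {set G} => #|border Z|) PZ) => Z0 /andP[s1 s2] min0.
apply: leq_trans (min0 _ PZ); apply: big => //.
apply: (good_cut gY s2) => W sW1 sW2; apply: min0.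
by rewrite /P (subset_trans s1).
Qed.

(** The [i] old branch sets and a new one starting at [y] are carried to the border of [Y] along the
    linkage. *)
Lemma transversal_model_step i : i < n -> ~ good setT ->
  transversal_model i -> transversal_model i.+1.
Proof.
move=> ltin ngT [W [X [f [b [cW coW mX pm [eX fb]]]]]].
have nX : X != setT by apply/eqP => XT; case: mX => gX _ _; rewrite XT in gX.
have nW : W != setT.
  by apply/eqP => WT; move: ltin; rewrite -cW WT cardsT T_card ltnNge leqnSn.
have [v [y [vW cvW yX vy]]] := extension_point nX nW coW fb.
have [Y [mY eY sY eX' [g [g1 g2]]]] := maximal_link ltin mX eX yX.
rewrite eX' in g1 g2.
have gsub u : u \in y |: border X ->
    [/\ u \in g u, connected_set (g u) & g u \subset u |: ~: (y |: X)].
  move=> /g1[a c /subsetP d _]; split=> //; apply/subsetP => z /d.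
  rewrite in_setU1 in_setD => /orP[/eqP->|/andP[z1 _]]; rewrite !in_setU1 ?eqxx //.
  by rewrite in_setC z1 orbT.
pose f' w := if w == v then g y else f w :|: g (b w).
have pm' : partial_model (v |: W) f' := partial_model_extend pm fb vW yX vy gsub g2.
pose r w := if w == v then y else b w.
have rin w : w \in v |: W -> r w \in y |: border X.
  rewrite /r in_setU1; case: eqP => [_ _|_ /= /fb[_ _ bX]]; rewrite in_setU1 ?eqxx //.
  by rewrite bX orbT.
have rf w : g (r w) \subset f' w.
  by rewrite /r /f'; case: eqP => // _; apply: subsetUr.
have ex w : exists z, w \in v |: W -> z \in f' w /\ z \in border Y.
  case: (boolP (w \in v |: W)) => [wW|_]; last by exists y.
  have [_ _ _ [z zg zY]] := g1 _ (rin _ wW).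
  by exists z; split=> //; apply: (subsetP (rf w)).
have [b' b'P] := choice ex.
exists (v |: W), Y, f', b'; split=> //.
- by rewrite cardsU1 vW cW.
- by right.
split=> // w wW; have [? ?] := b'P _ wW; split=> //.
have gY u : u \in y |: border X -> g u \subset Y.
  move=> uX; have [_ _ /subsetP d _] := g1 _ uX; apply/subsetP => z /d.
  rewrite in_setU1 in_setD => /orP[/eqP->|/andP[_ //]].
  apply: (subsetP sY); move: uX; rewrite !in_setU1 => /orP[->//|].
  by move/(subsetP (boundary_sub _ _ _))=> ->; rewrite orbT.
move: (rin _ wW) => /gY; rewrite /f' /r; move: wW; rewrite in_setU1.
case: eqP => // _ /= wW gbY; rewrite subUset gbY andbT.
have [fX _ _] := fb _ wW; apply: subset_trans fX (subset_trans _ sY).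
exact: subsetUr.
Qed.

(** Menger's theorem is applied once more, now up to the whole graph and with the vertices of [S]
    outside [X] as sinks; the linkage leads all [n.+1] branch sets to [S]. *)
Lemma no_transversal_model : transversal_model n -> good setT.
Proof.
move=> [W [X [f [b [cW coW [gX cX mX] pm [eX fb]]]]]]; apply: contrapT => ngT.
have nX : X != setT by apply/eqP => XT; rewrite XT in gX.
have nW : W != setT.
  by apply/eqP => WT; move/eqP: cW; rewrite WT cardsT T_card eqn_leq ltnn.
have [v [y [vW cvW yX vy]]] := extension_point nX nW coW fb.
pose B := S :\: X.
have cy : #|y |: border X| = n.+1.
  by rewrite cardsU1 eX (contra (subsetP (boundary_sub _ _ _) y) yX).
have sX' : boundary (@adj G) B (y |: X) \subset y |: border X.
  apply/subsetP => u /boundaryP[]; rewrite !in_setU1 => /orP[->//|uX].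
  rewrite in_setD uX => -[//|[w]].
  rewrite in_setU1 negb_or => /andP[_ wX] auw; apply/orP; right.
  by apply/borderP; split=> //; exists w.
(* A boundary of at most [n] vertices could serve as the next adhesion set. It contains all vertices
   of [S] in [Z] minus [X], so [Z] would be good, against the maximality of [X]. *)
have big Z : y |: X \subset Z -> n < #|boundary (@adj G) B Z|.
  move=> sZ; rewrite ltnNge; apply/negP => cZ.
  have sXZ : X \subset Z by apply: subset_trans sZ; apply: subsetUr.
  have sbZ : border Z \subset boundary (@adj G) B Z.
    by apply/subsetP => u /borderP[uZ [w wZ auw]]; apply/boundaryP; split=> //; right; exists w.
  have gZ : good Z.
    apply: (good_step gX sXZ sbZ (boundary_sub _ _ _) cZ).
    rewrite leqNgt; apply/negP => /ltnW/card_gt0P[u].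
    rewrite in_setD in_setI in_setD => /and3P[/boundaryP ub uS /andP[uX uZ]].
    by apply: ub; split=> //; left; rewrite in_setD uX.
  have eZ := mX Z gZ sXZ (leq_trans (subset_leq_card sbZ) cZ).
  by move: (subsetP sZ y); rewrite setU11 eZ (negPf yX) => /(_ isT).
have eX' : boundary (@adj G) B (y |: X) = y |: border X.
  by apply/eqP; rewrite eqEcard sX' cy big.
have [|g [g1 g2]] := @linkage G (@adj G) B (y |: X) setT (fun _ _ a => a) (subsetT _).
  by move=> Z sZ _; rewrite eX' cy big.
rewrite eX' in g1 g2.
have gsub u : u \in y |: border X ->
    [/\ u \in g u, connected_set (g u) & g u \subset u |: ~: (y |: X)].
  by move=> /g1[a c d _]; split=> //; rewrite setTD in d.
pose f' w := if w == v then g y else f w :|: g (b w).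
have [m1 m2 m3] : partial_model (v |: W) f' := partial_model_extend pm fb vW yX vy gsub g2.
have all w : w \in v |: W.
  have -> : v |: W = setT.
    by apply/eqP; rewrite eqEcard subsetT cardsU1 vW cW cardsT T_card leqnn.
  by rewrite inE.
have M1 w w' : w != w' -> [disjoint f' w & f' w'] by apply: m2.
apply: no_model; exists (@Model T G f' M1 (fun w => m1 w (all w))
  (fun w w' => m3 w w' (all w) (all w'))).
move=> w /=.
have rin : (if w == v then y else b w) \in y |: border X.
  have := all w; rewrite in_setU1; case: eqP => [_ _|_ /= /fb[_ _ bX]]; rewrite in_setU1 ?eqxx //.
  by rewrite bX orbT.
(* Nothing lies outside the whole vertex set, so its boundary consists of sinks, which belong to
   [S]. *)
have [_ _ _ [z zg /boundaryP[_ [|[u]]]]] := g1 _ rin; last by rewrite inE.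
rewrite in_setD => /andP[_ zS]; exists z => //.
by move: zg; rewrite /f'; case: eqP => // _ zg; rewrite inE zg orbT.
Qed.

Lemma good_setT : good setT.
Proof.
apply: contrapT => ngT.
have b0 : border (set0 : {set G}) = set0.
  by apply/setP => u; rewrite in_set0; apply/negP => /borderP[]; rewrite inE.
have tm i : i <= n -> transversal_model i.
  elim: i => [_|i IH ltin]; last by apply: transversal_model_step => //; apply/IH/ltnW.
  have [|X mX _] := @maximal_goodP 0 set0 (good0 _ _); first by rewrite b0 cards0.
  have [_ cX _] := mX.
  (* The subtree is empty at the start; [y] is just a default value for [b]. *)
  have [y] : exists y, y \notin X.
    apply: contrapT => no; apply: ngT; have [gX _ _] := mX.
    suff <- : X = setT by [].
    by apply/setP => u; rewrite inE; apply: contrapT => /negP uX; apply: no; exists u.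
  exists set0, X, (fun=> set0), (fun=> y); split=> //.
  - by rewrite cards0.
  - by left.
  - by split=> w; rewrite inE.
  - by split=> [|w]; [apply/eqP; rewrite -leqn0|rewrite inE].
exact: ngT (no_transversal_model (tm n (leqnn n))).
Qed.

End RootedPathwidth.

(** * Rooted models of complete trees *)

Section DaryModels.
Variables (G : sgraph) (S : {set G}) (d : nat).
Implicit Types (R U A F : {set G}).

(* U is connected and contains an S-rooted model of the complete d-ary tree of height h
   whose root branch set (A in the recursive case) meets R. *)
Fixpoint dary h R U : Prop := connected_set U /\
  if h is h'.+1 then exists A (Fs : seq {set G}),
    [/\ A \subset U /\ connected_set A,
        exists2 r, r \in A & r \in R,
        exists2 s, s \in A & s \in S,
        size Fs = d /\ pairwise (fun E F : {set G} => [disjoint E & F]) Fs &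
        forall F, F \in Fs ->
          [/\ F \subset U, [disjoint F & A] & dary h' (neighbourhood A) F]]
  else (exists2 r, r \in U & r \in R) /\ (exists2 s, s \in U & s \in S).

Lemma dary_conn h R U : dary h R U -> connected_set U.
Proof. by case: h => [|h] []. Qed.

Lemma dary_root h R U : dary h R U -> exists2 s, s \in U & s \in S.
Proof.
case: h => [|h] [_]; first by case.
by case=> A [Fs [[/subsetP AU _] _ [s sA sS] _ _]]; exists s; rewrite ?AU.
Qed.

Lemma dary_meet h R U : dary h R U -> exists2 r, r \in U & r \in R.
Proof.
case: h => [|h] [_]; first by case.
by case=> A [Fs [[/subsetP AU _] [r rA rR] _ _ _]]; exists r; rewrite ?AU.
Qed.

Lemma dary_sub h R R' U : dary h R U -> U :&: R \subset R' -> dary h R' U.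
Proof.
move=> dU /subsetP sR.
case: h dU => [|h] [cU]; last first.
  case=> A [Fs [[/subsetP AU cA] [r rA rR] rS sFs aFs]]; split=> //.
  exists A, Fs; split=> //; first by split=> //; apply/subsetP.
  by exists r => //; apply: sR; rewrite inE AU.
by case=> -[r rU rR] rS; split=> //; split=> //; exists r => //; apply: sR; rewrite inE rU.
Qed.

(** These words are the vertices of the complete [d]-ary tree of height [h]: the root is the empty
    word, and the children of [w] are the words [rcons w i]. *)
Definition valid_word h (w : seq nat) := (size w <= h) && all (gtn d) w.

(** The recursion is unfolded: the root receives [A], and the words starting with [i] are placed
    inside the [i]-th set of [Fs], whose root branch set meets the neighbourhood of [A]. *)
Lemma dary_words h R U : dary h R U -> exists beta : seq nat -> {set G},
  [/\ exists2 r, r \in beta [::] & r \in R,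
      forall w, valid_word h w -> [/\ connected_set (beta w), beta w \subset U &
        exists2 s, s \in beta w & s \in S],
      forall w w', valid_word h w -> valid_word h w' -> w != w' ->
        [disjoint beta w & beta w'] &
      forall w i, valid_word h (rcons w i) ->
        exists x y, [/\ x \in beta w, y \in beta (rcons w i) & adj x y]].
Proof.
elim: h R U => [|h IH] R U [cU].
  move=> [rR rS]; exists (fun=> U); split=> //.
  - by case=> [|i w] // [|i' w'].
  - by case=> [|j w] i.
case=> A [Fs [[AU cA] rR rS [sFs pFs] aFs]].
have ex i : exists beta : seq nat -> {set G}, i < d ->
  [/\ exists2 r, r \in beta [::] & r \in neighbourhood A,
      forall w, valid_word h w -> [/\ connected_set (beta w),
        beta w \subset nth set0 Fs i & exists2 s, s \in beta w & s \in S],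
      forall w w', valid_word h w -> valid_word h w' -> w != w' ->
        [disjoint beta w & beta w'] &
      forall w j, valid_word h (rcons w j) ->
        exists x y, [/\ x \in beta w, y \in beta (rcons w j) & adj x y]].
  case: (ltnP i d) => [ltid|_]; last by exists (fun=> set0).
  have [|_ _ /IH[beta]] := aFs (nth set0 Fs i); first by rewrite mem_nth ?sFs.
  by exists beta.
have [bs bsP] := choice ex.
have inF i : i < d -> nth set0 Fs i \in Fs by move=> ltid; rewrite mem_nth ?sFs.
have validS i w : valid_word h.+1 (i :: w) -> i < d /\ valid_word h w.
  by rewrite /valid_word /= ltnS => /and3P[-> -> ->].
have dA i w : valid_word h.+1 (i :: w) -> [disjoint bs i w & A].
  move=> /validS[ltid vw]; have [_ /(_ w vw)[_ sF _] _ _] := bsP i ltid.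
  by have [_ dF _] := aFs _ (inF _ ltid); apply: disjointWl sF dF.
exists (fun w => if w is i :: w' then bs i w' else A); split=> //.
- case=> [_|i w /validS[ltid vw]] //.
  have [_ /(_ w vw)[c sF ?] _ _] := bsP i ltid; split=> //.
  by have [sU _ _] := aFs _ (inF _ ltid); apply: subset_trans sF sU.
- case=> [|i w] [|j w'] // vw vw' nw.
  + by rewrite disjoint_sym dA.
  + exact: dA.
  have [ltid vw1] := validS _ _ vw; have [ltjd vw1'] := validS _ _ vw'.
  have [_ bi bdis _] := bsP i ltid.
  have [ij|nij] := eqVneq i j.
    by rewrite -ij in vw1' nw *; apply: bdis => //; apply: contra nw => /eqP->.
  have [_ bj _ _] := bsP j ltjd.
  have [_ si _] := bi _ vw1; have [_ sj _] := bj _ vw1'.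
  apply: disjointWl si (disjointWr sj _).
  have /(pairwiseP set0) pF := pFs; case: (ltngtP i j) nij => // lij _.
    by apply: pF; rewrite ?inE ?sFs.
  by rewrite disjoint_sym; apply: pF; rewrite ?inE ?sFs.
- case=> [|i w] j; rewrite /= => vw.
    have [ltjd _] := validS _ _ vw; have [[r rb rN] _ _ _] := bsP j ltjd.
    move: rN; rewrite inE => /andP[_ /exists_inP[x xA axr]].
    by exists x, r.
  by have [ltid vw1] := validS _ _ vw; have [_ _ _ ] := bsP i ltid; apply.
Qed.

End DaryModels.

(** * Embedding a tree into a complete tree *)

Section TreeWords.
Variable T : sgraph.
Hypothesis T_tree : is_tree T.

Lemma distP (u v : T) :
  (exists p, [/\ path (@adj T) u p, last u p = v & size p = dist u v]) /\
  (forall p, path (@adj T) u p -> last u p = v -> dist u v <= size p).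
Proof.
have [[p pP] minp] : (exists p, [/\ path (@adj T) u p, last u p = v & size p = dist u v]) /\
  forall k, (exists p, [/\ path (@adj T) u p, last u p = v & size p = k]) -> dist u v <= k.
  apply: minimum_natP; have [/andP[_ /forall_inP cT] _] := T_tree.
  have /connectP[p pth ->] := forall_inP (cT u (in_setT u)) v (in_setT v).
  exists (size p), p; split=> //; apply: sub_path pth => x y.
  by case/and3P.
by split=> [|q qp ql]; [exists p|apply: minp; exists q].
Qed.

Variable c : T.

Lemma dist_root : dist c c = 0.
Proof. by apply/eqP; rewrite -leqn0; apply: ((distP c c).2 [::]). Qed.

Lemma dist_adj u v : adj u v -> dist c v <= (dist c u).+1.
Proof.
move=> auv; have [[p [pp pl <-]] _] := distP c u.
rewrite -(size_rcons p v); apply: (distP c v).2; last by rewrite last_rcons.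
by rewrite rcons_path pp pl.
Qed.

Lemma dist_eq0 v : dist c v = 0 -> v = c.
Proof.
move=> d0; have [[p [_ pl sp]] _] := distP c v.
by rewrite d0 in sp; rewrite -pl (size0nil sp).
Qed.

Lemma parent_exists : exists par : T -> T,
  forall v, v != c -> adj (par v) v /\ dist c (par v) < dist c v.
Proof.
suff ex v : exists u, v != c -> adj u v /\ dist c u < dist c v.
  by have [par parP] := choice ex; exists par.
have [->|nvc] := eqVneq v c; first by exists c.
have [[p [pp pl sp]] _] := distP c v.
case/lastP: p pp pl sp => [|p z]; first by move=> _ /= cv; rewrite cv eqxx in nvc.
rewrite rcons_path last_rcons size_rcons => /andP[pp az] zv <-.
exists (last c p) => _; rewrite -zv; split=> //; rewrite ltnS.
exact: (distP c _).2.
Qed.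

(** The vertices other than [v] that are no farther from [c] than [v] form a connected set, since
    parents lead down to [c]. By acyclicity [v] has only one neighbour in it. *)
Lemma parent_unique (par : T -> T) u v :
  (forall v, v != c -> adj (par v) v /\ dist c (par v) < dist c v) ->
  v != c -> adj u v -> dist c u <= dist c v -> u = par v.
Proof.
move=> parP nvc auv duv; have [apv dpv] := parP _ nvc.
pose F := [set w | (dist c w <= dist c v) && (w != v)].
have cF : connected_set F.
  apply: (@connected_intro _ _ c); first by rewrite inE dist_root eq_sym nvc.
  move=> Z cZ clZ; apply/subsetP => w.
  have [m] := ubnP (dist c w); elim: m w => // m IH w; rewrite ltnS => dw wF.
  have [->//|nwc] := eqVneq w c; have [apw dpw] := parP _ nwc.
  have pwF : par w \in F.
    move: wF; rewrite !inE => /andP[dwv _].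
    rewrite (leq_trans (ltnW dpw) dwv) /=; apply/eqP => pv.
    by rewrite pv ltnNge dwv in dpw.
  by apply: clZ pwF wF apw (IH _ (leq_trans dpw dw) pwF).
apply: (@acyclic_attach T F v); rewrite ?inE ?eqxx ?andbF ?(adj_sym v) //.
- exact: T_tree.2.
- by rewrite duv; apply: contraTneq auv => ->; rewrite adj_irrefl.
- by rewrite ltnW //=; apply: contraTneq apv => ->; rewrite adj_irrefl.
Qed.

Lemma tree_words : exists wd : T -> seq nat,
  [/\ injective wd, forall v, valid_word (max_degree T) (eccentricity c) (wd v) &
      forall u v, adj u v ->
        (exists i, wd v = rcons (wd u) i) \/ (exists i, wd u = rcons (wd v) i)].
Proof.
have [par parP] := parent_exists.
have dpar v : v != c -> dist c v = (dist c (par v)).+1.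
  by move=> /parP[apv dpv]; apply/eqP; rewrite eqn_leq dist_adj.
(* The siblings of [v] are numbered among all neighbours of the parent, including the grandparent;
   the indices still stay below the maximum degree. *)
pose nb v := enum [set w | adj (par v) w].
pose word := fix word k v :=
  if k is k'.+1 then rcons (word k' (par v)) (index v (nb v)) else [::].
have sword k v : size (word k v) = k.
  by elim: k v => //= k IH v; rewrite size_rcons IH.
have nc v k : dist c v = k.+1 -> v != c.
  by move=> dv; apply/eqP => vc; rewrite vc dist_root in dv.
have vnb v : v != c -> v \in nb v by move=> /parP[apv _]; rewrite mem_enum inE.
have dword k v : dist c v = k -> all (gtn (max_degree T)) (word k v).
  elim: k v => //= k IH v dv; have nvc := nc _ _ dv.
  rewrite all_rcons IH ?andbT; last by move: (dpar _ nvc); rewrite dv => -[].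
  rewrite /=; apply: (@leq_trans (degree (par v))).
    by rewrite /degree cardE index_mem vnb.
  exact: leq_bigmax.
have wordI k u v : dist c u = k -> dist c v = k -> word k u = word k v -> u = v.
  elim: k u v => [u v /dist_eq0-> /dist_eq0->//|k IH u v du dv /=].
  move=> /rcons_inj[ew ei].
  have [nuc nvc] := (nc _ _ du, nc _ _ dv).
  have ep : par u = par v.
    by apply: IH => //; apply: succn_inj; rewrite -dpar.
  have uv : u \in nb v by rewrite /nb -ep vnb.
  have <- : nth u (nb v) (index u (nb v)) = u by apply: nth_index.
  have -> : index u (nb v) = index v (nb v) by rewrite -ei /nb ep.
  by rewrite nth_index ?vnb.
have adjw u v : adj u v -> dist c u <= dist c v ->
    exists i, word (dist c v) v = rcons (word (dist c u) u) i.
  move=> auv duv; have nvc : v != c.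
    apply: contraTneq auv => vc; move: duv; rewrite vc dist_root leqn0 => /eqP.
    by move/dist_eq0=> ->; rewrite adj_irrefl.
  have up := parent_unique parP nvc auv duv.
  by exists (index v (nb v)); rewrite dpar //= up.
exists (fun v => word (dist c v) v); split.
- move=> u v e; have ed : dist c u = dist c v by rewrite -(sword (dist c u) u) e sword.
  by apply: (wordI (dist c u)); rewrite // [in RHS]ed.
- move=> v; rewrite /valid_word sword dword // andbT.
  exact: (leq_bigmax (F := dist c)).
- move=> u v auv; case: (leqP (dist c u) (dist c v)) => [|/ltnW] duv.
    by left; apply: adjw.
  by right; apply: adjw; rewrite // adj_sym.
Qed.

End TreeWords.

(** Rooting [T] at a vertex [c] of minimum eccentricity embeds it into the complete tree whose
    height is the radius. *)
Lemma dary_model (G T : sgraph) (S R U : {set G}) : is_tree T ->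
  dary S (max_degree T) (radius T) R U -> exists M : model T G, rooted S M.
Proof.
move=> T_tree.
have [c0 _] := connected_neq0 T_tree.1.
have [[c <-] _] : (exists c : T, eccentricity c = radius T) /\
    forall n, (exists u : T, eccentricity u = n) -> radius T <= n.
  by apply: minimum_natP; exists (eccentricity c0), c0.
have [wd [wdI wdV wdA]] := tree_words T_tree c.
move=> /dary_words[beta [_ b1 b2 b3]].
have M1 (v w : T) : v != w -> [disjoint beta (wd v) & beta (wd w)].
  by move=> nvw; apply: b2 => //; apply: contra nvw => /eqP/wdI->.
have M2 (v : T) : connected_set (beta (wd v)) by have [] := b1 _ (wdV v).
have M3 (v w : T) : adj v w ->
    exists x y, [/\ x \in beta (wd v), y \in beta (wd w) & adj x y].
  move=> /wdA[[i e]|[i e]].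
    by rewrite e; apply: b3; rewrite -e.
  have [|x [y [xb yb axy]]] := b3 (wd w) i; first by rewrite -e.
  by exists y, x; split; rewrite ?e // adj_sym.
by exists (Model M1 M2 M3) => v; have [] := b1 _ (wdV v).
Qed.

(** * Operations on partition-path-decompositions *)

Section Decompositions.
Variables (G : sgraph) (S : {set G}) (k : nat).
Implicit Types (U A C X F : {set G}) (B : {set {set G}}) (D : seq {set {set G}}).

Definition parts D : {set {set G}} :=
  [set A | has (fun B : {set {set G}} => A \in B) D].

Lemma partsP D A : reflect (exists2 B, B \in D & A \in B) (A \in parts D).
Proof. by rewrite inE; apply: hasP. Qed.

Lemma parts_cat D1 D2 A : (A \in parts (D1 ++ D2)) = (A \in parts D1) || (A \in parts D2).
Proof. by rewrite !inE has_cat. Qed.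

(* A k-partition-path-decomposition of the subgraph induced by U. A bag is a set of
   parts, and the partition consists of the parts that occur in some bag. *)
Record decomp b U D : Prop := Decomp {
  dc_nonempty : D != [::];
  dc_bag : forall B, B \in D -> #|B| <= b;
  dc_part : forall A, A \in parts D -> [/\ A \subset U, #|A| <= k & A != set0];
  dc_disjoint : forall A A' x, A \in parts D -> A' \in parts D ->
    x \in A -> x \in A' -> A = A';
  dc_root : forall s, s \in U -> s \in S -> s \in cover (parts D);
  dc_edge : forall A A' x y, A \in parts D -> A' \in parts D ->
    x \in A -> y \in A' -> adj x y -> exists2 B, B \in D & (A \in B) && (A' \in B);
  dc_interval : forall A i j l, i <= j -> j <= l -> l < size D ->
    A \in nth set0 D i -> A \in nth set0 D l -> A \in nth set0 D j;
  dc_component : forall C, connected_set C -> C \subset U ->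
    [disjoint C & cover (parts D)] -> exists2 B, B \in D &
      forall x y, x \in C -> y \in cover (parts D) -> adj x y -> y \in cover B }.

Lemma decomp_unrooted b U : (forall s, s \in U -> s \in S -> False) ->
  decomp b U [:: set0].
Proof.
move=> noS.
have p0 A : A \in parts [:: set0] -> False by case/partsP=> B; rewrite inE => /eqP->; rewrite inE.
split=> //.
- by move=> B; rewrite inE => /eqP->; rewrite cards0.
- by move=> A /p0.
- by move=> A A' x /p0.
- by move=> s sU /noS -/(_ sU).
- by move=> A A' x y /p0.
- by move=> A [|i] [|j] [|l].
- by move=> C _ _ _; exists set0; rewrite ?inE // => x y _ /bigcupP[A /p0].
Qed.

(** A part lying in every bag takes care of all edges and components attached to it, at the cost of
    one more part per bag. *)
Lemma decomp_add b U D X : decomp b U D -> [disjoint X & U] -> #|X| <= k -> X != set0 ->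
  decomp b.+1 (U :|: X) [seq X |: B | B : {set {set G}} <- D].
Proof.
move=> [Dn Db Dp Dd Dr De Di Dc] dXU cX nX.
set D' := map _ D.
have mD' B : B \in D' -> exists2 B0, B0 \in D & B = X |: B0.
  by case/mapP=> B0; exists B0.
have inD' B : B \in D -> X |: B \in D' by move=> BD; apply/mapP; exists B.
have [B0 B0D] : exists B, B \in D.
  by case: D Dn {Db Dp Dd Dr De Di Dc D' mD' inD'} => // B D _; exists B; rewrite inE eqxx.
have eD' A : (A \in parts D') = (A == X) || (A \in parts D).
  apply/partsP/orP => [[_ /mD'[B BD ->]]|[/eqP->|/partsP[B BD AB]]].
  - by rewrite in_setU1 => /orP[->|AB]; [left|right; apply/partsP; exists B].
  - by exists (X |: B0); rewrite ?inD' // setU11.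
  - by exists (X |: B); rewrite ?inD' // in_setU1 AB orbT.
have cD' x : (x \in cover (parts D')) = (x \in X) || (x \in cover (parts D)).
  apply/bigcupP/orP => [[A]|[xX|/bigcupP[A AD xA]]].
  - rewrite eD' => /orP[/eqP-> ->|AD xA]; [by left|right].
    by apply/bigcupP; exists A.
  - by exists X; rewrite // eD' eqxx.
  - by exists A; rewrite // eD' AD orbT.
have XU A x : A \in parts D -> x \in A -> x \in X -> False.
  move=> /Dp[/subsetP sA _ _] xA xX; exact: (disjoint_setP _ _ dXU x xX (sA _ xA)).
split.
- by rewrite /D'; case: D Dn {Db Dp Dd Dr De Di Dc D' mD' inD' eD' cD' B0D XU}.
- move=> _ /mD'[B BD ->]; rewrite cardsU1 -add1n leq_add ?leq_b1 //; exact: Db.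
- move=> A; rewrite eD' => /orP[/eqP->|/Dp[sA cA nA]]; first by rewrite subsetUr.
  by split=> //; apply: subset_trans sA (subsetUl _ _).
- move=> A A' x; rewrite !eD' => /orP[/eqP->|AD] /orP[/eqP->|AD'] // xA xA'.
  + by case: (XU _ _ AD' xA').
  + by case: (XU _ _ AD xA).
  + exact: Dd AD AD' xA xA'.
- move=> s; rewrite inE cD' orbC => /orP[->//|sU] sS; by rewrite Dr ?orbT.
- move=> A A' x y; rewrite !eD' => /orP[/eqP->|AD] /orP[/eqP->|AD'] xA yA' axy.
  + by exists (X |: B0); rewrite ?inD' // setU11.
  + have /partsP[B BD AB] := AD'; exists (X |: B); rewrite ?inD' //.
    by rewrite setU11 in_setU1 AB orbT.
  + have /partsP[B BD AB] := AD; exists (X |: B); rewrite ?inD' //.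
    by rewrite setU11 in_setU1 AB orbT.
  + have [B BD /andP[AB AB']] := De _ _ _ _ AD AD' xA yA' axy.
    by exists (X |: B); rewrite ?inD' // !in_setU1 AB AB' !orbT.
- move=> A i j l ij jl; rewrite size_map => lD.
  have jD := leq_ltn_trans jl lD; have iD := leq_ltn_trans ij jD.
  rewrite !(nth_map set0) // !in_setU1; case: eqP => //= _.
  exact: Di.
- move=> C cC sC dC; have sCU : C \subset U.
    apply/subsetP => x xC; have := subsetP sC _ xC; rewrite inE => /orP[//|xX].
    by case: (disjoint_setP _ _ dC x xC); rewrite cD' xX.
  have [|B BD hB] := Dc C cC sCU.
    by apply/disjoint_setP => x xC xD; apply: (disjoint_setP _ _ dC x xC); rewrite cD' xD orbT.
  exists (X |: B); first exact: inD'.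
  move=> x y xC; rewrite cD' => /orP[yX|yD] axy; apply/bigcupP.
    by exists X; rewrite ?setU11.
  have /bigcupP[A AB yA] := hB _ _ xC yD axy.
  by exists A; rewrite // in_setU1 AB orbT.
Qed.

Lemma decomp_weaken b b' U D : b <= b' -> decomp b U D -> decomp b' U D.
Proof.
by move=> bb' [? Db *]; split=> // B /Db cB; apply: leq_trans cB bb'.
Qed.

(** Parts are disjoint and [X], unless empty, is a part on both sides, so it is the only part that
    can meet both [U1] and [U2]. Its bags end [D1] and begin [D2], hence remain consecutive in the
    concatenation. *)
Lemma decomp_glue b U1 U2 X D1 D2 : decomp b U1 D1 -> decomp b U2 D2 ->
  U1 :&: U2 = X -> X = set0 \/ X \in last set0 D1 /\ X \in head set0 D2 ->
  (forall x y, x \in U1 -> x \notin U2 -> y \in U2 -> y \notin U1 -> ~~ adj x y) ->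
  decomp b (U1 :|: U2) (D1 ++ D2).
Proof.
move=> dc1 dc2 eX hX noE.
have [n1 b1 p1 d1 r1 e1 i1 c1] := dc1; have [n2 b2 p2 d2 r2 e2 i2 c2] := dc2.
have s1 : 0 < size D1 by case: (D1) n1.
have s2 : 0 < size D2 by case: (D2) n2.
have hX' x : x \in U1 -> x \in U2 -> [/\ x \in X, X \in parts D1, X \in parts D2,
    X \in nth set0 D1 (size D1).-1 & X \in nth set0 D2 0].
  move=> x1 x2; have xX : x \in X by rewrite -eX inE x1.
  case: hX => [X0|[X1 X2]]; first by rewrite X0 inE in xX.
  have X1' : X \in nth set0 D1 (size D1).-1 by rewrite nth_last.
  have X2' : X \in nth set0 D2 0 by rewrite nth0.
  by split=> //; apply/partsP;
    [exists (nth set0 D1 (size D1).-1)|exists (nth set0 D2 0)];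
    rewrite ?mem_nth ?prednK.
have share1 A x : A \in parts D1 -> x \in A -> x \in U2 -> A = X.
  move=> A1 xA x2; have [/subsetP sA _ _] := p1 _ A1.
  have [xX X1 _ _ _] := hX' x (sA _ xA) x2; exact: d1 A1 X1 xA xX.
have share2 A x : A \in parts D2 -> x \in A -> x \in U1 -> A = X.
  move=> A2 xA x1; have [/subsetP sA _ _] := p2 _ A2.
  have [xX _ X2 _ _] := hX' x x1 (sA _ xA); exact: d2 A2 X2 xA xX.
have sub1 A x : A \in parts D1 -> x \in A -> x \in U1.
  by move=> /p1[/subsetP sA _ _]; apply: sA.
have sub2 A x : A \in parts D2 -> x \in A -> x \in U2.
  by move=> /p2[/subsetP sA _ _]; apply: sA.
have common A : A \in parts D1 -> A \in parts D2 ->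
    [/\ A = X, X \in nth set0 D1 (size D1).-1 & X \in nth set0 D2 0].
  move=> A1 A2; have [_ _ /set0Pn[x xA]] := p1 _ A1.
  have x2 := sub2 _ _ A2 xA; split; first exact: share1 A1 xA x2.
    by have [] := hX' x (sub1 _ _ A1 xA) x2.
  by have [] := hX' x (sub1 _ _ A1 xA) x2.
have catl B : B \in D1 -> B \in D1 ++ D2 by rewrite mem_cat => ->.
have catr B : B \in D2 -> B \in D1 ++ D2 by rewrite mem_cat orbC => ->.
have edge12 A A' x y : A \in parts D1 -> A' \in parts D2 -> x \in A -> y \in A' ->
    adj x y -> exists2 B, B \in D1 ++ D2 & (A \in B) && (A' \in B).
  move=> A1 A2 xA yA' axy.
  have x1 := sub1 _ _ A1 xA; have y2 := sub2 _ _ A2 yA'.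
  case: (boolP (x \in U2)) => [x2|nx2].
    have [xX _ X2 _ _] := hX' x x1 x2; have eA := share1 _ _ A1 xA x2.
    by rewrite eA in xA *; have [B BD ?] := e2 _ _ _ _ X2 A2 xX yA' axy; exists B; rewrite ?catr.
  case: (boolP (y \in U1)) => [y1|ny1].
    have [yX X1 _ _ _] := hX' y y1 y2; have eA := share2 _ _ A2 yA' y1.
    by rewrite eA in yA' *; have [B BD ?] := e1 _ _ _ _ A1 X1 xA yX axy; exists B; rewrite ?catl.
  by have := noE _ _ x1 nx2 y2 ny1; rewrite axy.
have cover_cat x : x \in cover (parts (D1 ++ D2)) ->
    x \in cover (parts D1) \/ x \in cover (parts D2).
  case/bigcupP=> A; rewrite parts_cat => /orP[AD|AD] xA; [left|right];
    by apply/bigcupP; exists A.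
have coverl x : x \in cover (parts D1) -> x \in cover (parts (D1 ++ D2)).
  by case/bigcupP=> A AD xA; apply/bigcupP; exists A; rewrite // parts_cat AD.
have coverr x : x \in cover (parts D2) -> x \in cover (parts (D1 ++ D2)).
  by case/bigcupP=> A AD xA; apply/bigcupP; exists A; rewrite // parts_cat AD orbT.
have noE' x y : x \in U1 -> x \notin U2 -> adj x y -> y \in U2 -> y \in U1.
  move=> x1 x2 axy y2; apply: contraT => y1.
  by have := noE _ _ x1 x2 y2 y1; rewrite axy.
have noE'' x y : x \in U2 -> x \notin U1 -> adj x y -> y \in U1 -> y \in U2.
  move=> x2 x1; rewrite adj_sym => axy y1; apply: contraT => y2.
  by have := noE _ _ y1 y2 x2 x1; rewrite axy.
have coverX x : x \in U1 -> x \in U2 ->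
    x \in cover (parts D1) /\ x \in cover (parts D2).
  move=> x1 x2; have [xX X1 X2 _ _] := hX' x x1 x2.
  by split; apply/bigcupP; exists X.
have cov1 x : x \in cover (parts D1) -> x \in U1.
  by case/bigcupP=> A AD xA; apply: sub1 AD xA.
have cov2 x : x \in cover (parts D2) -> x \in U2.
  by case/bigcupP=> A AD xA; apply: sub2 AD xA.
split.
- by case: (D1) n1.
- by move=> B; rewrite mem_cat => /orP[/b1|/b2].
- move=> A; rewrite parts_cat => /orP[/p1|/p2] [sA cA nA]; split=> //;
    by apply: subset_trans sA _; rewrite ?subsetUl ?subsetUr.
- move=> A A' x; rewrite !parts_cat => /orP[A1|A2] /orP[A1'|A2'] xA xA'.
  + exact: d1 A1 A1' xA xA'.
  + by rewrite (share1 _ _ A1 xA (sub2 _ _ A2' xA')) (share2 _ _ A2' xA' (sub1 _ _ A1 xA)).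
  + by rewrite (share1 _ _ A1' xA' (sub2 _ _ A2 xA)) (share2 _ _ A2 xA (sub1 _ _ A1' xA')).
  + exact: d2 A2 A2' xA xA'.
- by move=> s; rewrite inE => /orP[sU|sU] sS; [apply/coverl/r1|apply/coverr/r2].
- move=> A A' x y; rewrite !parts_cat => /orP[A1|A2] /orP[A1'|A2'] xA yA' axy.
  + by have [B BD ?] := e1 _ _ _ _ A1 A1' xA yA' axy; exists B; rewrite ?catl.
  + exact: edge12 A1 A2' xA yA' axy.
  + rewrite adj_sym in axy; have [B BD] := edge12 _ _ _ _ A1' A2 yA' xA axy.
    by rewrite andbC; exists B.
  + by have [B BD ?] := e2 _ _ _ _ A2 A2' xA yA' axy; exists B; rewrite ?catr.
- move=> A i j l ij jl; rewrite size_cat => lD; rewrite !nth_cat.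
  case: (ltnP l (size D1)) => [l1|l2].
    have j1 := leq_ltn_trans jl l1; rewrite j1 (leq_ltn_trans ij j1).
    exact: i1.
  have lD2 : l - size D1 < size D2 by rewrite ltn_subLR.
  case: (ltnP i (size D1)) => [i1'|i2'] Ai Al.
    have A1 : A \in parts D1 by apply/partsP; exists (nth set0 D1 i); rewrite ?mem_nth.
    have A2 : A \in parts D2.
      by apply/partsP; exists (nth set0 D2 (l - size D1)); rewrite ?mem_nth.
    have [eA X1 X2] := common _ A1 A2; rewrite eA in Ai Al *.
    case: (ltnP j (size D1)) => [j1|j2].
      by apply: (i1 X i j (size D1).-1) => //; rewrite -ltnS prednK.
    by apply: (i2 X 0 _ (l - size D1)) => //; apply: leq_sub2r.
  rewrite ltnNge (leq_trans i2' ij) /=.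
  by apply: (i2 A (i - size D1) _ (l - size D1)) => //; apply: leq_sub2r.
(* Being uncovered, [C] avoids the intersection of [U1] and [U2]. So it stays on one side, where its
   covered neighbours lie as well. *)
- move=> C cC sC /disjoint_setP dC.
  have nX x : x \in C -> x \in U1 -> x \in U2 -> False.
    by move=> xC x1 x2; apply: (dC x xC); apply: coverl; have [] := coverX x x1 x2.
  have [[x0 x0C x01]|no1] := pselect (exists2 x, x \in C & x \in U1).
    have /subsetP C1 : C \subset U1.
      apply: (connected_closed cC x0C x01) => u v uC vC auv u1.
      have u2 : u \notin U2 by apply/negP => u2; apply: nX uC u1 u2.
      have := subsetP sC _ vC; rewrite inE => /orP[//|]; exact: noE' u1 u2 auv.
    have [||B BD hB] := c1 C cC; first by apply/subsetP.
      by apply/disjoint_setP => x xC /coverl; apply: dC.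
    exists B; rewrite ?catl // => x y xC yc axy; apply: (hB x) => //.
    case: (cover_cat _ yc) => // yc2; have y2 := cov2 _ yc2.
    have x2 : x \notin U2 by apply/negP => x2; apply: nX xC (C1 _ xC) x2.
    by have [] := coverX y (noE' _ _ (C1 _ xC) x2 axy y2) y2.
  have C2 x : x \in C -> x \in U2.
    move=> xC; have := subsetP sC _ xC; rewrite inE => /orP[x1|//].
    by case: no1; exists x.
  have [||B BD hB] := c2 C cC; first by apply/subsetP.
    by apply/disjoint_setP => x xC /coverr; apply: dC.
  exists B; rewrite ?catr // => x y xC yc axy; apply: (hB x) => //.
  case: (cover_cat _ yc) => // yc1; have y1 := cov1 _ yc1.
  have x1 : x \notin U1 by apply/negP => x1; apply: no1; exists x.
  by have [] := coverX y y1 (noE'' _ _ (C2 _ xC) x1 axy y1).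
Qed.

End Decompositions.

Lemma neighbourhoodP (G : sgraph) (W : {set G}) y :
  reflect (y \notin W /\ exists2 x, x \in W & adj x y) (y \in neighbourhood W).
Proof. by rewrite inE; apply: (iffP andP) => -[yW /exists_inP]. Qed.

(** * Layering by hitting sets *)

Section Layers.
Variables (G : sgraph) (S : {set G}) (n d : nat).
Hypothesis goodG : good S n [set: G].
Hypothesis d_gt0 : 0 < d.
Implicit Types (R U W A C X F : {set G}).

(** This is the part size [(2t-1)d] for [t = n+1]. *)
Let k := d * n.*2.+1.

(** Equivalently, every component of the subgraph induced by [W] meets [R]. *)
Definition touches R W := forall v, v \in W -> exists F,
  [/\ connected_set F, F \subset W, v \in F & exists2 r, r \in F & r \in R].

Definition decomposable h := forall R W, (forall F, F \subset W -> ~ dary S d h R F) ->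
  touches R W -> exists D, decomp S k h.*2 W D.

(** A vertex of [S] in [W], joined to [R] inside [W], would give a tree of height 0; so there is
    nothing to cover. *)
Lemma decomposable0 : decomposable 0.
Proof.
move=> R W noF tW; exists [:: set0]; apply: decomp_unrooted => s sW sS.
have [F [cF sF vF rF]] := tW _ sW; apply: (noF F sF).
by split=> //; split=> //; exists s.
Qed.

(** The union of the components of the subgraph induced by [W] that meet [R]. *)
Definition touching R W : {set G} := [set v | `[< exists F,
  [/\ connected_set F, F \subset W, v \in F & exists2 r, r \in F & r \in R] >]].

Lemma touchingP R W v : reflect (exists F,
  [/\ connected_set F, F \subset W, v \in F & exists2 r, r \in F & r \in R])
  (v \in touching R W).
Proof. by rewrite inE; apply: asboolP. Qed.

Lemma touching_sub R W : touching R W \subset W.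
Proof. by apply/subsetP => v /touchingP[F [_ /subsetP sF vF _]]; apply: sF. Qed.

Lemma sub_touching R W F r : connected_set F -> F \subset W -> r \in F -> r \in R ->
  F \subset touching R W.
Proof.
by move=> cF sF rF rR; apply/subsetP => v vF; apply/touchingP; exists F; split=> //; exists r.
Qed.

Lemma touching_touches R W : touches R (touching R W).
Proof.
move=> v /touchingP[F [cF sF vF [r rF rR]]]; exists F; split=> //.
  exact: sub_touching cF sF rF rR.
by exists r.
Qed.

Lemma touching_closed R W u v : u \in touching R W -> v \in W -> adj u v ->
  v \in touching R W.
Proof.
move=> /touchingP[F [cF sF uF [r rF rR]]] vW auv; apply/touchingP; exists (F :|: [set v]).
split; first exact: connectedU_adj cF (connected1 v) uF (set11 v) auv.
- by rewrite subUset sF sub1set.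
- by rewrite !inE eqxx orbT.
- by exists r; rewrite // inE rF.
Qed.

Lemma hitting_set h R U A : ~ dary S d h.+1 R U -> connected_set U -> A \subset U ->
  connected_set A -> (exists2 r, r \in A & r \in R) ->
  exists2 K : {set G}, #|K| <= k &
    forall F, dary S d h (neighbourhood A) F -> F \subset U :\: A -> ~~ [disjoint F & K].
Proof.
move=> nU cU sA cA [r rA rR].
pose Fam F := dary S d h (neighbourhood A) F /\ F \subset U :\: A.
have rFam : rooted_family S Fam.
  by move=> F [dF _]; split; [apply: dary_conn dF|apply: dary_root dF].
have [[Fs [sFs aFs pFs]]|[K cK hK]] := erdos_posa d goodG rFam; last first.
  by exists K => // F dF sF; apply: hK.
(* Of [d.+1] disjoint members, [F0] is merged into [A] to provide a vertex of [S]; the other [d]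
   become the subtrees below the root. *)
case: nU; case: Fs sFs aFs pFs => // F0 Fs [sFs] aFs /= /andP[/allP d0 pFs].
have [dF0 sF0] := aFs F0 (mem_head _ _).
have [y yF0 /neighbourhoodP[yA [x xA axy]]] := dary_meet dF0.
have [s sF0' sS] := dary_root dF0.
have sub F : F \subset U :\: A -> F \subset U /\ [disjoint F & A].
  by rewrite subsetD => /andP[].
split=> //; exists (A :|: F0), Fs; split=> //.
- split; first by rewrite subUset sA; have [-> _] := sub _ sF0.
  exact: connectedU_adj cA (dary_conn dF0) xA yF0 axy.
- by exists r; rewrite // inE rA.
- by exists s; rewrite // inE sF0' orbT.
move=> F FFs; have [dF sF] : Fam F by apply: aFs; rewrite inE FFs orbT.
have [FU FA] := sub _ sF; have F0F := d0 _ FFs.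
have dA' : [disjoint F & A :|: F0].
  by apply/disjoint_setP => u uF; rewrite inE => /orP[uA|u0];
    [apply: (disjoint_setP _ _ FA u)|apply: (disjoint_setP _ _ F0F u)].
split=> //; apply: dary_sub dF _; apply/subsetP => u.
rewrite in_setI => /andP[uF /neighbourhoodP[_ [z zA azu]]]; apply/neighbourhoodP; split.
  by apply/negP; apply: (disjoint_setP _ _ dA' u).
by exists z; rewrite // inE zA.
Qed.

(** [A] is the region already treated and [X] the part through which it is joined to the rest. The
    region [W] reached from [A] without entering the hitting set [K] is decomposed by the hypothesis
    on [h], and both [X] and the next part [X'] are added to all its bags. Induction on the rest of
    [U] continues from [A], [W] and [X'] together; [X] in the first bag is what makes gluing
    possible. *)
Lemma layer h R U : decomposable h -> ~ dary S d h.+1 R U -> connected_set U ->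
  forall A X, A \subset U -> connected_set A -> (exists2 r, r \in A & r \in R) ->
  X \subset A -> X != set0 -> #|X| <= k ->
  (forall u v, u \in A -> v \in U :\: A -> adj u v -> u \in X) ->
  exists2 D, decomp S k h.+1.*2 ((U :\: A) :|: X) D & X \in head set0 D.
Proof.
move=> dech nU cU A X; have [m] := ubnP #|U :\: A|.
elim: m A X => // m IH A X; rewrite ltnS => ltm sA cA rA sX nX cX frX.
have [K cK hK] := hitting_set nU cU sA cA rA.
pose N := neighbourhood A; pose V := U :\: A :\: K; pose W := touching N V.
have WV : W \subset V := touching_sub _ _.
have inV v : v \in V -> [/\ v \in U, v \notin A & v \notin K].
  by rewrite !in_setD => /and3P[].
have inW v : v \in W -> [/\ v \in U, v \notin A & v \notin K].
  by move=> vW; apply/inV/(subsetP WV).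
have [D0 dc0] : exists D, decomp S k h.*2 W D.
  apply: (dech N) => [F sF dF|]; last exact: touching_touches.
  have sFU : F \subset U :\: A.
    by apply/subsetP => v /(subsetP sF)/inW[vU vA _]; rewrite in_setD vA.
  apply: (negP (hK F dF sFU)).
  by apply/disjoint_setP => v /(subsetP sF)/inW[_ _ /negP].
pose A1 := A :|: W.
have cA1 : connected_set A1.
  apply: connected_star => // v vW; have [F [cF sF vF [r rF]]] := touching_touches vW.
  move=> /neighbourhoodP[_ [a aA aar]].
  exists ([set a] :|: F); split.
  - exact: connectedU_adj (connected1 a) cF (set11 a) rF aar.
  - by apply: setUSS; rewrite // sub1set.
  - by rewrite inE vF orbT.
  - by exists a; rewrite // !inE eqxx.
(* [W] absorbs everything reachable outside [K], so the next vertices of [U] all lie in [K] and form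
   a part of size at most [k]. *)
pose X' := U :&: neighbourhood A1.
have X'P v : v \in X' -> [/\ v \in U, v \notin A, v \notin W & exists2 a, a \in A1 & adj a v].
  rewrite in_setI => /andP[vU /neighbourhoodP[]].
  by rewrite in_setU negb_or => /andP[vA vW] ex.
have inX' u v : u \in A1 -> v \in U -> v \notin A1 -> adj u v -> v \in X'.
  by move=> uA1 vU vA1 auv; rewrite in_setI vU; apply/neighbourhoodP; split=> //; exists u.
have sX'U : X' \subset U by apply: subsetIl.
clearbody X'.
have sX'K : X' \subset K.
  apply/subsetP => v /X'P[vU vA vW [a aA1 aav]]; apply: contraT => vK.
  case/negP: vW; have vV : v \in V by rewrite !in_setD vK vA.
  move: aA1; rewrite in_setU => /orP[aA|aW]; last exact: touching_closed aW vV aav.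
  apply: (subsetP (sub_touching (connected1 v) _ (set11 v) _)) (set11 v).
    by rewrite sub1set.
  by apply/neighbourhoodP; split=> //; exists a.
have cX' : #|X'| <= k by apply: leq_trans cK; apply: subset_leq_card.
have dc1 : decomp S k h.*2.+1 (W :|: X) [seq X |: B | B : {set {set G}} <- D0].
  apply: decomp_add => //; apply/disjoint_setP => v /(subsetP sX) vA /inW[_ /negP].
  by move/(_ vA).
set D1 := map _ D0 in dc1.
have hD1 : X \in head set0 D1.
  by move: (dc_nonempty dc0); rewrite /D1; case: (D0) => //= B D _; rewrite setU11.
(* Parts are nonempty, hence the case distinction. If [X'] is empty, the connected set [U] is
   exhausted by [A1]. *)
have [X'0|nX'] := eqVneq X' set0.
  exists D1 => //.
  have UA1 : U \subset A1.
    have [r rA' _] := rA.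
    apply: (connected_closed cU (subsetP sA _ rA')); first by rewrite inE rA'.
    move=> u v _ vU auv uA1; apply: contraT => vA1.
    by have := inX' _ _ uA1 vU vA1 auv; rewrite X'0 inE.
  have -> : (U :\: A) :|: X = W :|: X.
    congr (_ :|: X); apply/eqP; rewrite eqEsubset; apply/andP; split; apply/subsetP => v.
      rewrite in_setD => /andP[vA /(subsetP UA1)]; rewrite in_setU.
      by rewrite (negPf vA).
    by move=> /inW[vU vA _]; rewrite in_setD vA.
  by apply: decomp_weaken dc1; rewrite doubleS.
pose A2 := A1 :|: X'.
have sA1U : A1 \subset U.
  by rewrite subUset sA; apply/subsetP => v /inW[].
have dA1 v : v \in A1 -> v \in X' -> False.
  by move=> vA1 /X'P[_ vA vW _]; move: vA1; rewrite in_setU (negPf vA) (negPf vW).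
have frX' u v : u \in A2 -> v \in U :\: A2 -> adj u v -> u \in X'.
  rewrite in_setU => /orP[uA1|//]; rewrite in_setD in_setU negb_or.
  move=> /andP[/andP[vA1 vX'] vU] auv; case/negP: vX'; exact: inX' uA1 vU vA1 auv.
have [|||||D2 dc2 hD2] := IH A2 X' _ _ _ _ _ nX' cX' frX'.
- apply: leq_trans ltm; apply: proper_card; rewrite properE; apply/andP; split.
    by apply: setDS; rewrite /A2 /A1 -setUA subsetUl.
  have [v vX'] := set0Pn _ nX'; have [vU vA _ _] := X'P _ vX'.
  by apply/subsetPn; exists v; rewrite !in_setD ?vA // in_setU vX' orbT.
- by rewrite subUset sA1U.
- apply: connected_star => // v vX'; have [_ _ _ [a aA1 aav]] := X'P _ vX'.
  exists ([set a] :|: [set v]); split.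
  + exact: connectedU_adj (connected1 a) (connected1 v) (set11 a) (set11 v) aav.
  + by apply: setUSS; rewrite sub1set.
  + by rewrite !inE eqxx orbT.
  + by exists a; rewrite // !inE eqxx.
- by have [r rA' rR] := rA; exists r; rewrite // !in_setU rA'.
- exact: subsetUr.
have dc3 : decomp S k h.+1.*2 (W :|: X :|: X') [seq X' |: B | B : {set {set G}} <- D1].
  rewrite doubleS; apply: decomp_add => //; apply/disjoint_setP => v vX'.
  rewrite in_setU => vWX; apply: (dA1 v) vX'; rewrite in_setU.
  by case/orP: vWX => [->|/(subsetP sX)->]; rewrite ?orbT.
set D3 := map _ D1 in dc3.
have hD3 : X \in head set0 D3.
  move: (dc_nonempty dc1) hD1; rewrite /D3; case: (D1) => //= B D _ XB.
  by rewrite in_setU1 XB orbT.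
have lD3 : X' \in last set0 D3.
  move: (dc_nonempty dc1); rewrite /D3; case/lastP: (D1) => // D B _.
  by rewrite map_rcons last_rcons setU11.
exists (D3 ++ D2); last first.
  by move: (dc_nonempty dc3) hD3; case: (D3).
have A2P v : v \in U -> (v \in A2) = [|| v \in A, v \in W | v \in X'].
  by move=> vU; rewrite !in_setU orbA.
have -> : (U :\: A) :|: X = (W :|: X :|: X') :|: (U :\: A2 :|: X').
  apply/setP => v; rewrite !in_setU !in_setD !in_setU.
  case vX : (v \in X); first by rewrite !orbT.
  case vX' : (v \in X'); first by have [-> -> _ _] := X'P _ vX'; rewrite !orbT.
  case vW : (v \in W); first by have [-> -> _] := inW _ vW.
  by rewrite !orbF.
apply: decomp_glue dc3 dc2 _ _ _; first reflexivity.
- have -> : (W :|: X :|: X') :&: (U :\: A2 :|: X') = X'; last by right.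
  apply/setP => v; rewrite !in_setI !in_setU !in_setD !in_setU.
  case vX' : (v \in X'); first by rewrite !orbT.
  rewrite !orbF; case vW : (v \in W); first by rewrite /= orbT.
  by case vX : (v \in X); rewrite //= (subsetP sX _ vX).
move=> x y; rewrite !in_setU => xU; rewrite negb_or => /andP[_ xX'].
move=> yU; rewrite negb_or => /andP[_ yX'].
apply/negP => axy; case/negP: xX'; apply: (frX' x y) => //.
  rewrite !in_setU; case/orP: xU => [/orP[->|/(subsetP sX)->]|->]; by rewrite ?orbT.
by move: yU; rewrite (negPf yX') orbF.
Qed.

(** The components of [W] are treated one at a time and concatenated along the empty set. In each,
    the layers start from a single vertex of [R], which is a part of admissible size as [d] is
    positive. *)
Lemma decomposableS h : decomposable h -> decomposable h.+1.
Proof.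
move=> dech R W; have [m] := ubnP #|W|.
elim: m W => // m IH W; rewrite ltnS => ltm noF tW.
have [->|/set0Pn[v vW]] := eqVneq W set0.
  by exists [:: set0]; apply: decomp_unrooted => s; rewrite inE.
have [F [_ sF _ [r rF rR]]] := tW _ vW.
have rW := subsetP sF _ rF.
pose C := touching [set r] W.
have CW : C \subset W := touching_sub _ _.
have rC : r \in C.
  apply: (subsetP (sub_touching (connected1 r) _ (set11 r) (set11 r))) (set11 r).
  by rewrite sub1set.
have eC : [set r] :|: C = C by apply/setUidPr; rewrite sub1set.
have cC : connected_set C.
  rewrite -eC; apply: connected_star; first exact: connected1.
  move=> u /touching_touches[E [cE sE uE rE]]; exists E; split=> //.
  by rewrite eC.
have [|||||||D1 dc1 _] := @layer h R C dech (noF _ CW) cC [set r] [set r].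
- by rewrite sub1set.
- exact: connected1.
- by exists r; rewrite ?inE.
- by [].
- by apply/set0Pn; exists r; rewrite inE.
- by rewrite cards1 muln_gt0 d_gt0.
- by [].
have eC' : (C :\ r) :|: [set r] = C by rewrite setUC setD1K.
rewrite eC' in dc1.
have closedC E : connected_set E -> E \subset W -> (exists2 u, u \in E & u \in C) ->
    E \subset C.
  move=> cE /subsetP sE [u uE uC]; apply: (connected_closed cE uE uC) => x y _ yE axy xC.
  exact: touching_closed xC (sE _ yE) axy.
have [|||D2 dc2] := IH (W :\: C).
- apply: leq_trans ltm; apply: proper_card; rewrite properE subsetDl.
  by apply/subsetPn; exists r; rewrite // in_setD rC.
- by move=> E sE; apply: noF; apply: subset_trans sE (subsetDl _ _).
- move=> u; rewrite in_setD => /andP[uC uW].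
  have [E [cE sE uE rE]] := tW _ uW; exists E; split=> //.
  apply/subsetP => x xE; rewrite in_setD (subsetP sE) // andbT.
  apply: contra uC => xC; apply: (subsetP (closedC E cE sE _)) uE.
  by exists x.
exists (D1 ++ D2); have -> : W = C :|: (W :\: C).
  by apply/setP => x; rewrite in_setU in_setD; case xC: (x \in C) => //=; rewrite (subsetP CW).
apply: decomp_glue dc1 dc2 (erefl _) _ _.
  by left; apply/setP => x; rewrite in_setI in_setD in_set0; case: (x \in C).
move=> x y xC _; rewrite in_setD => /andP[yC yW] _; apply: contra yC.
exact: touching_closed xC yW.
Qed.

Lemma decomposable_all h : decomposable h.
Proof. by elim: h => [|h]; [apply: decomposable0|apply: decomposableS]. Qed.

Lemma decomp_exists h : (forall R F, ~ dary S d h R F) ->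
  exists D, decomp S k h.*2 [set: G] D.
Proof.
move=> noF; apply: (@decomposable_all h setT) => // v _.
by exists [set v]; split; rewrite ?connected1 ?subsetT ?set11 //; exists v; rewrite inE.
Qed.

End Layers.

(** * From lists of sets of parts to bags of the quotient *)

Section Assembly.
Variables (G : sgraph) (S : {set G}) (k b : nat) (D : seq {set {set G}}).
Hypothesis dcD : decomp S k b [set: G] D.

Definition quotient_bag (B : {set {set G}}) : {set quotient (parts D)} :=
  [set A | val A \in B].

Definition quotient_bags := map quotient_bag D.

Lemma quotient_bag_cover B : B \in D ->
  \bigcup_(A in quotient_bag B) val A = cover B.
Proof.
move=> BD; apply/setP => x; apply/bigcupP/bigcupP => -[A AB xA].
  by exists (val A); rewrite // inE in AB.
have AD : A \in parts D by apply/partsP; exists B.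
by exists (exist _ A AD : quotient (parts D)); rewrite ?inE.
Qed.

Lemma parts_partition : partition (parts D) (cover (parts D)).
Proof.
apply/and3P; split=> //.
  apply/trivIsetP => A A' AD AD' nAA'; apply/disjoint_setP => x xA xA'.
  by case/eqP: nAA'; apply: dc_disjoint dcD _ _ _ AD AD' xA xA'.
by apply/negP => /(dc_part dcD)[_ _]; rewrite eqxx.
Qed.

Lemma quotient_path_decomposition : path_decomposition quotient_bags.
Proof.
split.
- by rewrite -size_eq0 size_map size_eq0; apply: dc_nonempty dcD.
- move=> A; have /partsP[B BD AB] := valP A.
  by exists (quotient_bag B); rewrite ?map_f // inE.
- move=> A A' /andP[_ /exists_inP[x xA /exists_inP[y yA' axy]]].
  have [B BD AB] := dc_edge dcD (valP A) (valP A') xA yA' axy.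
  by exists (quotient_bag B); rewrite ?map_f // !inE.
- move=> A i j l ij jl; rewrite size_map => lD.
  have jD := leq_ltn_trans jl lD; have iD := leq_ltn_trans ij jD.
  rewrite !(nth_map set0) // !inE; exact: (dc_interval dcD).
Qed.

Lemma ppd_of_decomp : exists E : ppd k S, (ppd_width E <= b%:Z - 1)%R.
Proof.
have sS : S \subset cover (parts D).
  by apply/subsetP => s sS; apply: (dc_root dcD); rewrite ?inE.
have wP : partition_width (parts D) <= k.
  by apply/bigmax_leqP => A /(dc_part dcD)[].
have comp C : component (~: cover (parts D)) C -> exists2 B, B \in quotient_bags &
    neighbourhood C \subset \bigcup_(A in B) val A.
  move=> /maxsetP[/andP[sC cC] mC].
  have [|B BD hB] := dc_component dcD cC (subsetT _).
    by rewrite disjoints_subset.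
  exists (quotient_bag B); first exact: map_f.
  rewrite quotient_bag_cover //; apply/subsetP => y /neighbourhoodP[yC [x xC axy]].
  (* An uncovered neighbour [y] could be added to [C], which is a maximal connected set of uncovered
     vertices. *)
  apply: (hB x) => //; apply: contraT => yD; case/negP: yC.
  rewrite -(mC (C :|: [set y]) _ (subsetUl _ _)) ?inE ?eqxx ?orbT //.
  rewrite subUset sC sub1set in_setC yD /=.
  exact: connectedU_adj cC (connected1 y) xC (set11 y) axy.
exists (@PPD k G S _ sS _ parts_partition wP _ quotient_path_decomposition comp).
rewrite /ppd_width /pd_width /= Num.Theory.lerD2r lez_nat.
apply/bigmax_leqP_seq => _ /mapP[B BD ->] _.
apply: leq_trans (dc_bag dcD BD).
rewrite -(card_imset _ val_inj); apply: subset_leq_card.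
by apply/subsetP => _ /imsetP[A AB ->]; rewrite inE in AB.
Qed.

End Assembly.

(** * The bound on the partition-path-width *)

Theorem theorem18 (G : sgraph) (S : {set G}) (T : sgraph) (t d h : nat)
    (T_tree : is_tree T) (T_card : #|T| = t) (t_ge2 : 2 <= t)
    (T_deg : max_degree T = d) (T_rad : radius T = h)
    (no_model : ~ exists M : model T G, rooted S M) :
  (ppw ((2 * t - 1) * d) S <= 2 * h%:Z - 1)%R.
Proof.
case: t T_card t_ge2 => // n T_card n_gt0.
(* A tree with at least two vertices has an edge. Positivity of [d] makes the part size positive, so
   that the minimum defining [ppw] is attained. *)
have d_gt0 : 0 < d.
  have [c _] := connected_neq0 T_tree.1.
  have ncT : [set c] != setT :> {set T}.
    by apply: contraTneq n_gt0 => e; rewrite -T_card -cardsT -e cards1.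
  have [v [_ _ [e|[w _ avw]] _]] := tree_grow T_tree (or_intror (connected1 c)) ncT.
    by move/setP/(_ c): e; rewrite !inE eqxx.
  rewrite -T_deg; apply: leq_trans (leq_bigmax (F := @degree T) v).
  by apply/card_gt0P; exists w; rewrite inE.
have ek : (2 * n.+1 - 1) * d = d * n.*2.+1.
  by rewrite mulnC mul2n doubleS subn1.
have goodG := good_setT T_tree T_card no_model.
have [D dcD] : exists D, decomp S (d * n.*2.+1) h.*2 [set: G] D.
  apply: decomp_exists => // R F; rewrite -T_deg -T_rad => dF; apply: no_model.
  exact: dary_model T_tree dF.
have [E wE] := ppd_of_decomp dcD.
rewrite ek; apply: Order.POrderTheory.le_trans ((ppwP S _).2 E) _.
  by rewrite muln_gt0 d_gt0.
apply: Order.POrderTheory.le_trans wE _.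
by rewrite -mul2n PoszM.
Qed.
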